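(* Let $0<s<\infty$ and let $(X,\mathscr{B},\mu,\rho)$ be a compact Ahlfors $s$-regular probability space, with generalized dyadic cubes $\mathcal{Q}_n$, $n\ge0$, of parameter $0<b<1/3$. For each $n\ge1$ let $\{Z_n(Q):Q\in\mathcal{Q}_n\}$ be random variables with values in $\{0,1\}$, all defined on a common probability space, and let $A=\limsup_{n\to\infty}A(n)$ be the associated limsup random fractal, where $A(n)=\bigcup_{Q\in\mathcal{Q}_n,\,Z_n(Q)=1}Q^o$. Let $\gamma_1,\gamma_2$ be its indices and suppose that $A$ satisfies the Correlation Condition with constant $\delta\ge0$. If $\gamma_2+\delta<s$, then $A\in\mathcal{G}^{s-\gamma_2-\delta}(X)$ almost surely.
   Context: For a metric space $(X,\rho)$, $B(x,r)=\{y\in X:\rho(x,y)<r\}$ and $\overline{B}(x,r)=\{y\in X:\rho(x,y)\le r\}$. $\mathscr{B}$ is the Borel $\sigma$-algebra. A Borel measure $\mu$ is Ahlfors $s$-regular ($0<s<\infty$) if there is $1\le C<\infty$ with $C^{-1}r^s\le\mu(B(x,r))\le Cr^s$ for all $x\in X$ and $0<r\le\operatorname{diam}X$. A compact Ahlfors $s$-regular probability space $(X,\mathscr{B},\mu,\rho)$ means: $(X,\rho)$ is a compact metric space and $\mu$ is an Ahlfors $s$-regular Borel probability measure on it (this is a standing assumption); then $\tau:=\dim_{\rm H}X=s$. For sets $F_n$, $\limsup_{n\to\infty}F_n=\bigcap_{m\ge1}\bigcup_{n\ge m}F_n$. $Q^o$ is the interior of $Q$. Generalized dyadic cubes: fix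 $0<b<1/3$ and put $c_1=\frac12-\frac{b}{1-b}$, $c_1'=\frac1{1-b}$. Fix a family of Borel sets $\{Q_{n,i}: n\in\mathbb{Z}, i\in\mathbb{N}_n\subset\mathbb{N}\}$ (which exists by a known theorem) such that: (1) $X=\bigcup_{i\in\mathbb{N}_n}Q_{n,i}$ for every $n$, the sets $Q_{n,i}$ with the same $n$ and distinct $i$ being disjoint; (2) for $n\ge m$, either $Q_{n,i}\cap Q_{m,j}=\varnothing$ or $Q_{n,i}\subset Q_{m,j}$; (3) for each $n,i$ there is $x_{n,i}\in X$ with $B(x_{n,i},c_1b^n)\subset Q_{n,i}\subset\overline{B}(x_{n,i},c_1'b^n)$; (4) there is $x_0\in X$ such that for every $n$ there is $i$ with $B(x_0,c_1b^n)\subset Q_{n,i}$; (5) $\{x_{n,i}\}_{i\in\mathbb{N}_n}\subset\{x_{n+1,i}\}_{i\in\mathbb{N}_{n+1}}$ for all $n$. Put $\mathcal{Q}_0=\{X\}$, $\mathcal{Q}_n=\{Q_{n,i}:i\in\mathbb{N}_n\}$ for $n\ge1$, and $\mathcal{Q}=\bigcup_{n\ge0}\mathcal{Q}_n$. Large intersection classes: for $0<t\le\tau$ and $F\subset X$ let $\mathscr{M}^t_\infty(F)=\inf\{\sum_{i}\mu(Q_i)^{t/\tau}: F\subset\bigcup_{i}Q_i,\ Q_i\in\mathcal{Q}\}$ (countable covers). $\mathcal{G}^t(X)$ is the class of all $G_\delta$ sets $F\subset X$ such that for every $0<t'<t$ and every $Q\in\mathcal{Q}$, $\mathscr{M}^{t'}_\infty(F\cap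 Q)=\mathscr{M}^{t'}_\infty(Q)$. Indices: with $P_n(Q)=\mathbb{P}(Z_n(Q)=1)$ (and $\log 0=-\infty$), \[\gamma_1=-\limsup_{n\to\infty}\frac{\max_{Q\in\mathcal{Q}_n}\log_{b^{-1}}P_n(Q)}{n},\qquad \gamma_2=-\limsup_{n\to\infty}\frac{\min_{Q\in\mathcal{Q}_n}\log_{b^{-1}}P_n(Q)}{n}.\] Correlation Condition with constant $\delta\ge0$: for all $\epsilon>0$, $\limsup_{n\to\infty}\frac1n\log_{b^{-1}}f(n,\epsilon)\le\delta$, where \[f(n,\epsilon)=\max_{Q\in\mathcal{Q}_n}\#\{Q'\in\mathcal{Q}_n:\operatorname{Cov}(Z_n(Q),Z_n(Q'))\ge\epsilon P_n(Q)P_n(Q')\}.\] *)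

(* Defs.v *)
From HB Require Import structures.
From mathcomp Require Import all_boot all_order all_algebra.
From mathcomp Require Import all_classical all_reals all_analysis.
From mathcomp Require Import borel_hierarchy.
Import Order.TTheory GRing.Theory Num.Theory.
Import numFieldNormedType.Exports.

Set Implicit Arguments.
Unset Strict Implicit.
Unset Printing Implicit Defensive.

Local Open Scope classical_set_scope.
Local Open Scope ring_scope.

(* [g_sigma_algebraType] asks for a pointed carrier; this only excludes the
   empty metric space, which carries no probability measure. *)
#[short(type="pmetricType")]
HB.structure Definition PointedMetric (K : numDomainType) :=
  {M of Metric K M & Pointed M}.

Notation borel X := (g_sigma_algebraType (@open X)).

Section metric_space.
Context {R : realType} {X : pmetricType R}.
Implicit Types (x : X) (r : R) (E : set X).

(* The open ball B(x,r) is the library's [ball x r], see [ballEmdist]. The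
   library's [closed_ball] is the closure of [ball x r], which can be strictly
   smaller than the set below. *)
Definition cball x r : set X := [set y | mdist x y <= r].

(* The point 0 is added so that the empty set has diameter 0. *)
Definition diam E : \bar R :=
  ereal_sup (0%E |` [set (mdist p.1 p.2)%:E | p in E `*` E]).

Definition hausdorff_content (t e : R) E : \bar R :=
  ereal_inf [set (\sum_(0 <= i <oo) (diam (C i) `^ t))%E | C in
    [set C : nat -> set X |
      E `<=` \bigcup_i C i /\ forall i, (diam (C i) <= e%:E)%E]].

Definition hausdorff_measure (t : R) E : \bar R :=
  ereal_sup [set hausdorff_content t e E | e in [set e | 0 < e]].

Definition hausdorff_dim E : \bar R :=
  ereal_inf [set t%:E | t in [set t : R | 0 < t /\ hausdorff_measure t E = 0%E]].

(* On a one-point space no radius satisfies 0 < r <= diam X, so the estimate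
   holds vacuously for every s although the Hausdorff dimension is 0; results
   that use dim X = s need X to have two points. *)
Definition ahlfors_regular (mu : set X -> \bar R) (s : R) : Prop :=
  exists2 C : R, 1 <= C & forall x r, 0 < r -> (r%:E <= diam [set: X])%E ->
    ((C^-1 * r `^ s)%:E <= mu (ball x r) <= (C * r `^ s)%:E)%E.

End metric_space.

Definition dyadic_c1 {R : realType} (b : R) : R := 1 / 2 - b / (1 - b).
Definition dyadic_c1' {R : realType} (b : R) : R := 1 / (1 - b).

(* [dy_cube n i] and [dy_center n i] are only meaningful when [dy_index n i]. *)
Record dyadic_cubes (R : realType) (X : pmetricType R) (b : R) := DyadicCubes {
  dy_index : int -> set nat ;
  dy_cube : int -> nat -> set X ;
  dy_center : int -> nat -> X ;
  dy_borel : forall n i, dy_index n i ->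
    measurable (dy_cube n i : set (borel X)) ;
  dy_cover : forall n, \bigcup_(i in dy_index n) dy_cube n i = [set: X] ;
  dy_disjoint : forall n i j, dy_index n i -> dy_index n j -> i != j ->
    dy_cube n i `&` dy_cube n j = set0 ;
  dy_nested : forall m n i j, (m <= n)%R -> dy_index n i -> dy_index m j ->
    dy_cube n i `&` dy_cube m j = set0 \/ dy_cube n i `<=` dy_cube m j ;
  dy_ball : forall n i, dy_index n i ->
    ball (dy_center n i) (dyadic_c1 b * b ^ n) `<=` dy_cube n i /\
    dy_cube n i `<=` cball (dy_center n i) (dyadic_c1' b * b ^ n) ;
  dy_base : exists x0 : X, forall n, exists2 i, dy_index n i &
    ball x0 (dyadic_c1 b * b ^ n) `<=` dy_cube n i ;
  dy_center_incr : forall n,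
    dy_center n @` dy_index n `<=` dy_center (n + 1) @` dy_index (n + 1) }.

Section large_intersection.
Context {R : realType} {X : pmetricType R} {b : R}.
Variables (mu : set X -> \bar R) (D : dyadic_cubes X b).

Definition cubes (n : nat) : set (set X) :=
  if n is 0%N then [set [set: X]]
  else dy_cube D n%:Z @` dy_index D n%:Z.

Definition all_cubes : set (set X) := \bigcup_n cubes n.

(* Covers are indexed by an arbitrary set of naturals, so finite covers and,
   for the empty set, the empty cover are allowed. *)
Definition cube_content (t : R) (F : set X) : \bar R :=
  let tau := fine (hausdorff_dim [set: X]) in
  ereal_inf [set v | exists (I : set nat) (C : nat -> set X),
    [/\ forall i, I i -> all_cubes (C i),
        F `<=` \bigcup_(i in I) C i &
        v = (\esum_(i in I) (mu (C i) `^ (t / tau)))%E]].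

Definition large_intersection (t : R) (F : set X) : Prop :=
  Gdelta F /\
  forall (t' : R) (Q : set X), 0 < t' -> t' < t -> all_cubes Q ->
    cube_content t' (F `&` Q) = cube_content t' Q.

End large_intersection.

Section limsup_fractal.
Context {R : realType} {X : pmetricType R} {b : R}.
Context {d : measure_display} {Omega : measurableType d}.
Variables (P : probability Omega R) (D : dyadic_cubes X b).
Variable Z : nat -> set X -> {RV P >-> R}.

Definition fractal_level (w : Omega) (n : nat) : set X :=
  \bigcup_(Q in [set Q | cubes D n Q /\ Z n Q w = 1]) Q°.

Definition limsup_fractal (w : Omega) : set X :=
  lim_sup_set (fractal_level w).

Definition hit_prob (n : nat) (Q : set X) : \bar R :=
  P [set w | Z n Q w = 1].

(* Logarithm in base 1/b; [lne 0 = -oo]. *)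
Definition logb (y : \bar R) : \bar R := (lne y * ((ln b^-1)^-1)%:E)%E.

(* The families [cubes D n] are finite when X is compact, so that the suprema
   and infima over them below are maxima and minima. *)
Definition gamma1 : \bar R :=
  (- limn_esup (fun n =>
     ereal_sup [set logb (hit_prob n Q) | Q in cubes D n] * (n%:R^-1)%:E))%E.

Definition gamma2 : \bar R :=
  (- limn_esup (fun n =>
     ereal_inf [set logb (hit_prob n Q) | Q in cubes D n] * (n%:R^-1)%:E))%E.

Definition corr_count (n : nat) (eps : R) : \bar R :=
  ereal_sup [set counting [set Q' | cubes D n Q' /\
      (eps%:E * hit_prob n Q * hit_prob n Q' <= covariance P (Z n Q) (Z n Q'))%E]
    | Q in cubes D n].

Definition correlation_condition (delta : R) : Prop :=
  forall eps : R, 0 < eps ->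
    (limn_esup (fun n => (n%:R^-1)%:E * logb (corr_count n eps)) <= delta%:E)%E.

End limsup_fractal.

(* Main.v *)
Require Import Defs.
From HB Require Import structures.
From mathcomp Require Import all_boot all_order all_algebra.
From mathcomp Require Import all_classical all_reals all_analysis.
From mathcomp Require Import borel_hierarchy measurable_realfun finmap ring lra.
Import Order.TTheory GRing.Theory Num.Theory.
Import numFieldNormedType.Exports.


(** The key object is the random measure that gives every cube [Q] of level
    [n] the mass [vol Q * Z_n(Q) / P_n(Q)] ([weight]). On average it is the
    volume, and the Correlation Condition makes it concentrate: in the variance
    of the mass of a cube [B], a pair of cubes that is not strongly correlated
    contributes a small multiple of the product of the volumes, while the
    strongly correlated pairs are few, about [b ^ - (n * delta)] for each cube,
    and each of them costs at most [vol Q] times the largest weight, about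
    [b ^ (n * (s - gamma2))] at the infinitely many levels at which all hitting
    probabilities are at least about [b ^ (n * gamma2)]. Put [p = t' / s]
    with [t' < s - gamma2 - delta]. Divided by [vol B `^ p] and summed over
    the cubes [B] of all levels up to [n], these variances form two geometric
    sums, so the expected [discrepancy] between the random measure and the
    volume tends to zero along those levels ([ae_regular_weights]). By Markov's
    inequality the discrepancy is almost surely small at infinitely many
    levels. The ratio of weight to [vol Q `^ p] is bounded at the same levels.

    The rest is deterministic. Suppose that cubes [C_i] cover the part of the
    limsup set in a cube [Q] at a cost, the sum of the [vol C_i `^ p], below
    [vol Q `^ p]. Call [Q] under-covered. Since [p < 1], the total volume of
    the [C_i] is smaller than [vol Q] by a fixed amount. At a level [n] with
    small discrepancy the weight inside [Q] is nearly [vol Q] and, by the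
    Cauchy-Schwarz inequality, the weight inside the [C_i] of level at most
    [n] is nearly their volume; so some weight is left for cubes that are met
    by finer [C_i] only. These finer cubes are too cheap to cover all of that
    weight, hence some cube carrying weight contains, well inside, a smaller
    cube that is again under-covered ([under_covered_descent]). Iterating gives
    a nested sequence of cubes, and compactness a point of the limsup set in
    all of them. A [C_i] containing that point would contain a cube of the
    sequence, which an under-covered cube forbids ([uncovered_point]). So the
    content of the intersection is at least [vol Q `^ p], the cost of [Q]
    itself.

    The content is normalised by the Hausdorff dimension of [X], which is [s]
    ([hausdorff_dim_regular]). Countably many exponents suffice, because
    regularity for one exponent implies it for smaller ones
    ([regular_weights_le]). *)


Set Implicit Arguments.
Unset Strict Implicit.
Unset Printing Implicit Defensive.

Local Open Scope classical_set_scope.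
Local Open Scope ring_scope.

(** * Balls and diameters *)

Section metric_balls.
Context {R : realType} {X : pmetricType R}.
Implicit Types (x y : X) (r : R).

Lemma ball_open_mdist x r : open (ball x r).
Proof.
rewrite openE => y; rewrite ballEmdist /= => xy; rewrite /interior -nbhs_ballE.
exists (r - mdist x y) => /=; first by rewrite subr_gt0.
move=> z; rewrite !ballEmdist /= => yz.
by rewrite (le_lt_trans (metric_triangle x y z))// -ltrBrDl.
Qed.

Lemma cball_closed x r : closed (cball x r).
Proof.
rewrite -openC openE => y /= /negP; rewrite -ltNge => xy.
rewrite /interior -nbhs_ballE; exists (mdist x y - r); first by rewrite /= subr_gt0.
move=> z; rewrite ballEmdist /= => yz; apply/negP; rewrite -ltNge.
have := metric_triangle x z y; rewrite (metric_sym z y); lra.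
Qed.

Lemma open_borel (A : set X) : open A -> measurable (A : set (borel X)).
Proof. by move=> oA; apply: (@sub_sigma_algebra _ setT (@open X) A oA). Qed.

Lemma cball_borel x r : measurable (cball x r : set (borel X)).
Proof.
rewrite -[cball _ _]setCK; apply: measurableC; apply: open_borel.
by rewrite openC; exact: cball_closed.
Qed.

Lemma ball_borel x r : measurable (ball x r : set (borel X)).
Proof. by apply: open_borel; exact: ball_open_mdist. Qed.

Lemma mdist_le_diam (A : set X) x y : A x -> A y ->
  ((mdist x y)%:E <= diam A)%E.
Proof. by move=> Ax Ay; apply: ereal_sup_ubound; right; exists (x, y). Qed.

Lemma diam_ge0 (A : set X) : (0 <= diam A)%E.
Proof. by apply: ereal_sup_ubound; left. Qed.

Lemma diam_le (A : set X) r : 0 <= r ->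
  (forall x y, A x -> A y -> mdist x y <= r) -> (diam A <= r%:E)%E.
Proof.
move=> r0 Ar; apply: ge_ereal_sup => _ [->|[[x y] [/= Ax Ay] <-]].
  by rewrite lee_fin.
by rewrite lee_fin Ar.
Qed.

End metric_balls.

Section regular_measure.
Context {R : realType} {X : pmetricType R} {s : R}.
Variable mu : probability (borel X) R.
Hypothesis s_gt0 : 0 < s.
Hypothesis X_nontrivial : exists x y : X, x <> y.
Hypothesis mu_regular : ahlfors_regular mu s.

(** Beyond the diameter the upper estimate is free because the total mass is
    one, and below radius one the lower estimate only loses the factor by
    which the radius must shrink to fit under the diameter; so a single
    constant serves on the ranges of radii that are used. *)
Lemma ball_growth : exists2 K : R, 0 < K &
  (forall (x : X) (r : R), 0 < r -> (mu (ball x r) <= (K * r `^ s)%:E)%E) /\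
  (forall (x : X) (r : R), 0 < r <= 1 -> ((K^-1 * r `^ s)%:E <= mu (ball x r))%E).
Proof.
have [C C1 HC] := mu_regular; have C0 : 0 < C by apply: lt_le_trans C1.
have [x0 [y0 /eqP xy]] := X_nontrivial.
pose d0 := mdist x0 y0; have d00 : 0 < d0 by rewrite mdist_gt0.
have d0X : (d0%:E <= diam [set: X])%E by apply: mdist_le_diam.
(* radii up to one, shrunk by the factor e, do not exceed the diameter *)
pose e := Num.min 1 d0; have e0 : 0 < e by rewrite lt_min ltr01.
have es0 : 0 < e `^ s by apply: powR_gt0.
have ds0 : 0 < d0 `^ s by apply: powR_gt0.
exists (C + C / e `^ s + (d0 `^ s)^-1).
  by rewrite !addr_gt0// ?divr_gt0 ?invr_gt0.
split=> x r.
  move=> r0; have rs0 : 0 < r `^ s by apply: powR_gt0.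
  have [rd|/ltW dr] := leP r d0.
    have rX : (r%:E <= diam [set: X])%E by apply: le_trans d0X; rewrite lee_fin.
    have /andP[_ H] := HC x r r0 rX; apply: (le_trans H).
    rewrite lee_fin ler_pM2r// -addrA lerDl addr_ge0//.
      by rewrite divr_ge0// ltW.
    by rewrite invr_ge0 ltW.
  apply: (@le_trans _ _ 1%E); first by apply: probability_le1; exact: ball_borel.
  rewrite lee_fin (@le_trans _ _ ((d0 `^ s)^-1 * r `^ s))//.
    by rewrite mulrC ler_pdivlMr// mul1r ge0_ler_powR ?nnegrE// ltW.
  by rewrite ler_pM2r// lerDr addr_ge0 ?divr_ge0 ?ltW.
move=> /andP[r0 r1]; have rs0 : 0 < r `^ s by apply: powR_gt0.
have re0 : 0 < r * e by rewrite mulr_gt0.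
have re : r * e <= d0.
  apply: (@le_trans _ _ e); first exact: (ler_piMl (ltW e0) r1).
  by rewrite ge_min lexx orbT.
have reX : ((r * e)%:E <= diam [set: X])%E by apply: le_trans d0X; rewrite lee_fin.
have /andP[H _] := HC x (r * e) re0 reX.
apply: (le_trans _ (le_trans H _)); last first.
  apply: le_measure; [by apply: mem_set; apply: ball_borel..|].
  by apply: le_ball; apply: (ler_piMr (ltW r0)); rewrite ge_min lexx.
rewrite lee_fin (powRM _ (ltW r0) (ltW e0)) [r `^ s * _]mulrC mulrA ler_pM2r//.
rewrite -[C^-1 * _]invrK lef_pV2 ?posrE; last 2 first.
- by rewrite !addr_gt0// ?divr_gt0 ?invr_gt0.
- by rewrite invr_gt0 mulr_gt0// invr_gt0.
rewrite invfM invrK; rewrite -addrA addrCA lerDl addr_ge0 ?ltW// invr_gt0//.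
Qed.

End regular_measure.

(** * Geometry and volume of the cubes *)

Lemma powR_exprn {R : realType} (a r : R) n : 0 <= a ->
  (a ^+ n) `^ r = (a `^ r) ^+ n.
Proof. by move=> a0; rewrite -!powR_mulrn ?powR_ge0// powRAC. Qed.

Lemma expr_eventually_lt {R : realType} (a e : R) : 0 <= a < 1 -> 0 < e ->
  exists N, forall n, (N <= n)%N -> a ^+ n < e.
Proof.
move=> /andP[a0 a1] e0.
have /cvgrPdist_lt/(_ e e0)[N _ HN] : (GRing.exp a : R ^nat) @ \oo --> (0 : R).
  by apply: cvg_expr; rewrite ger0_norm.
exists N => n Nn; have := HN n Nn; rewrite /= sub0r normrN.
by rewrite ger0_norm ?exprn_ge0.
Qed.

Section cube_structure.
Context {R : realType} {X : pmetricType R} {b : R}.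
Variable D : dyadic_cubes X b.
Implicit Types (n k : nat) (Q B : set X).

Lemma cube_borel n Q : cubes D n Q -> measurable (Q : set (borel X)).
Proof.
by case: n => [->|n [i iD <-]]; [exact: measurableT|exact: dy_borel].
Qed.

Lemma cubes_cover n (x : X) : exists2 Q, cubes D n Q & Q x.
Proof.
case: n => [|n]; first by exists [set: X].
have : [set: X] x by [].
rewrite -(dy_cover D n.+1%:Z) => -[i iD xi].
by exists (dy_cube D n.+1%:Z i) => //; exists i.
Qed.

Lemma cubes_nested k n B Q : (k <= n)%N -> cubes D k B -> cubes D n Q ->
  B `&` Q !=set0 -> Q `<=` B.
Proof.
case: k n => [|k] [|n]//= kn; [by move=> -> _ _ ?..|].
move=> [j jD <-] [i iD <-] [x [xj xi]].
have kn' : (k.+1%:Z <= n.+1%:Z)%R by rewrite lez_nat.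
have [Q0|//] := dy_nested kn' iD jD.
by have : set0 x by rewrite -Q0.
Qed.

Lemma cubes_disjoint n Q B : cubes D n Q -> cubes D n B -> Q `&` B !=set0 ->
  Q = B.
Proof.
move=> nQ nB QB; apply/seteqP; split; last exact: (cubes_nested (leqnn n) nQ nB).
by apply: (cubes_nested (leqnn n) nB nQ); rewrite setIC.
Qed.

End cube_structure.

Definition volume {R : realType} {X : pmetricType R}
  (mu : probability (borel X) R) (Q : set X) : R := fine (mu Q).

Section cube_volume.
Context {R : realType} {X : pmetricType R} {s b : R}.
Variables (mu : probability (borel X) R) (D : dyadic_cubes X b).
Hypothesis s_gt0 : 0 < s.
Hypothesis X_nontrivial : exists x y : X, x <> y.
Hypothesis mu_regular : ahlfors_regular mu s.
Hypothesis b_bounds : 0 < b < 1 / 3.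
Implicit Types (n k : nat) (Q B : set X).

Local Notation vol := (volume mu).

Let b_gt0 : 0 < b. Proof. by case/andP: b_bounds. Qed.
Let b_lt1 : b < 1. Proof. by case/andP: b_bounds; lra. Qed.

Lemma dyadic_c1_gt0 : 0 < dyadic_c1 b.
Proof.
rewrite /dyadic_c1 subr_gt0 ltr_pdivrMr ?subr_gt0//.
by case/andP: b_bounds; lra.
Qed.

Lemma dyadic_c1_le1 : dyadic_c1 b <= 1.
Proof.
have : 0 <= b / (1 - b) by rewrite divr_ge0// ?subr_ge0 ltW.
rewrite /dyadic_c1; lra.
Qed.

Lemma dyadic_c1'_gt0 : 0 < dyadic_c1' b.
Proof. by rewrite divr_gt0// subr_gt0. Qed.

Lemma volE Q : measurable (Q : set (borel X)) -> mu Q = (vol Q)%:E.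
Proof. by move=> mQ; rewrite fineK// fin_num_measure. Qed.

Lemma cube_volE n Q : cubes D n Q -> mu Q = (vol Q)%:E.
Proof. by move=> /cube_borel; exact: volE. Qed.

Lemma vol_ge0 Q : 0 <= vol Q.
Proof. exact: fine_ge0. Qed.

Lemma vol_le1 n Q : cubes D n Q -> vol Q <= 1.
Proof.
move=> nQ; rewrite -lee_fin -(cube_volE nQ).
by apply: probability_le1; exact: (cube_borel nQ).
Qed.

Lemma vol_le k n B Q : cubes D k B -> cubes D n Q -> Q `<=` B -> vol Q <= vol B.
Proof.
move=> kB nQ QB; rewrite -lee_fin -(cube_volE nQ) -(cube_volE kB).
by apply: le_measure => //; apply: mem_set; [exact: (cube_borel nQ)|exact: (cube_borel kB)].
Qed.

(** A cube is squeezed between two concentric balls whose radii are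
    comparable to the same power of [b]. *)
Lemma cube_growth : exists2 K : R, 0 < K & forall n Q, cubes D n Q ->
  K^-1 * (b `^ s) ^+ n <= vol Q <= K * (b `^ s) ^+ n.
Proof.
have [K K0 [KU KL]] := ball_growth s_gt0 X_nontrivial mu_regular.
pose c := dyadic_c1 b; pose c' := 2 * dyadic_c1' b.
have c0 : 0 < c := dyadic_c1_gt0.
have c'0 : 0 < c' by rewrite mulr_gt0// dyadic_c1'_gt0.
have cs0 : 0 < c `^ s by apply: powR_gt0.
have c's0 : 0 < c' `^ s by apply: powR_gt0.
have bs n : (b ^+ n) `^ s = (b `^ s) ^+ n by rewrite powR_exprn// ltW.
have bn0 n : 0 < b ^+ n by rewrite exprn_gt0.
have bsn0 n : 0 < (b `^ s) ^+ n by rewrite exprn_gt0// powR_gt0.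
pose L := 1 + K * c' `^ s + K / c `^ s.
have KL0 : 0 < K / c `^ s by rewrite divr_gt0.
have KU0 : 0 < K * c' `^ s by rewrite mulr_gt0.
have L1 : 1 <= L by rewrite /L; lra.
have L0 : 0 < L by lra.
exists L => // -[|n] Q nQ.
  rewrite nQ /= expr0 !mulr1 /volume probability_setT /= L1 andbT.
  by rewrite invf_le1.
have {}nQ' := nQ; move: nQ' => [i iD QE].
have [] := dy_ball iD; rewrite QE -exprnP.
set x := dy_center _ _ _; set r := b ^+ n.+1 => xQ Qx.
have r1 : r <= 1 by rewrite exprn_ile1 ?ltW.
have cr0 : 0 < c * r by rewrite mulr_gt0// bn0.
have cr1 : c * r <= 1.
  by rewrite -[1]mulr1 ler_pM ?(ltW c0) ?(ltW (bn0 _)) ?dyadic_c1_le1.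
have c'r0 : 0 < c' * r by rewrite mulr_gt0// bn0.
apply/andP; split; rewrite -lee_fin -(cube_volE nQ).
  apply: le_trans (_ : (_ <= mu (ball x (c * r)))%E) _; last first.
    apply: le_measure; last exact: xQ.
      by apply: mem_set; apply: ball_borel.
    by apply: mem_set; exact: (cube_borel nQ).
  apply: le_trans (KL x (c * r) _); last by rewrite cr0.
  rewrite lee_fin powRM ?(ltW c0) ?(ltW (bn0 _))// bs mulrA ler_pM2r//.
  rewrite -[X in _ <= X]invrK lef_pV2 ?posrE//; last first.
    by rewrite invr_gt0 mulr_gt0// invr_gt0.
  by rewrite invfM invrK /L lerDr; lra.
apply: le_trans (_ : (_ <= mu (ball x (c' * r)))%E) _.
  apply: le_measure; [by apply: mem_set; exact: (cube_borel nQ)| |].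
    by apply: mem_set; apply: ball_borel.
  apply: (subset_trans Qx) => y; rewrite /cball ballEmdist /= => /le_lt_trans.
  apply; rewrite /c' -mulrA ltr_pMl ?ltr1n// mulr_gt0 ?dyadic_c1'_gt0 ?bn0//.
apply: le_trans (KU x (c' * r) c'r0) _.
rewrite lee_fin powRM ?(ltW c'0) ?(ltW (bn0 _))// bs mulrA ler_pM2r//.
rewrite /L; lra.
Qed.

Lemma vol_gt0 n Q : cubes D n Q -> 0 < vol Q.
Proof.
have [K K0 HK] := cube_growth => nQ; have /andP[+ _] := HK n Q nQ.
by apply: lt_le_trans; rewrite mulr_gt0 ?invr_gt0// exprn_gt0// powR_gt0.
Qed.

Lemma cube_neq0 n Q : cubes D n Q -> Q !=set0.
Proof.
move=> nQ; apply/set0P/eqP => Q0; have := vol_gt0 nQ.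
by rewrite Q0 /volume measure0 ltxx.
Qed.

Lemma sum_vol_bigcup n (F : {fset set X}) : [set` F] `<=` cubes D n ->
  \sum_(Q <- F) vol Q = vol (\bigcup_(Q in [set` F]) Q).
Proof.
move=> Fn.
have mF Q : Q \in F -> measurable (Q : set (borel X)).
  by move=> QF; exact: (cube_borel (Fn _ QF)).
have tF : trivIset [set` F] (fun Q : set X => Q).
  by move=> Q B /= /Fn nQ /Fn nB; exact: (cubes_disjoint nQ nB).
have := measure_fbigsetU mu mF tF.
rewrite /= bigcup_fset /= => H; rewrite /volume H.
rewrite [in RHS]big_seq -sum_fine; first by rewrite -big_seq.
by move=> Q QF; rewrite (cube_volE (Fn _ QF)).
Qed.

(** Disjoint cubes whose volumes are bounded below cannot be infinitely many
    in a space of total mass one. *)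
Lemma finite_cubes n : finite_set (cubes D n).
Proof.
have [K K0 HK] := cube_growth.
apply: contrapT => inf; pose c := K^-1 * (b `^ s) ^+ n.
have c0 : 0 < c by rewrite mulr_gt0 ?invr_gt0// exprn_gt0// powR_gt0.
have [F Fn FN] := infinite_set_fset (Num.truncn c^-1).+1 inf.
have : \sum_(Q <- F) vol Q <= 1.
  rewrite (sum_vol_bigcup Fn) -lee_fin -volE.
    apply: probability_le1; apply: fin_bigcup_measurable => // Q /Fn.
    exact: cube_borel.
  apply: fin_bigcup_measurable => // Q /Fn.
  exact: cube_borel.
apply/negP; rewrite -ltNge.
apply: (@lt_le_trans _ _ (\sum_(Q <- F) c)).
  rewrite big_const_seq count_predT iter_addr_0 -mulr_natl.
  rewrite -ltr_pdivrMr// mul1r (lt_le_trans (truncnS_gt _))// ler_nat//.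
rewrite big_seq [X in _ <= X]big_seq; apply: ler_sum => Q QF.
by have /andP[] := HK n Q (Fn _ QF).
Qed.

Definition cube_list n : {fset set X} := fset_set (cubes D n).

Lemma mem_cube_list n Q : (Q \in cube_list n) = `[< cubes D n Q >].
Proof.
rewrite in_fset_set; last exact: finite_cubes.
by apply/idP/asboolP => [/set_mem|/mem_set].
Qed.

Lemma sum_vol_subcubes k n B : (k <= n)%N -> cubes D k B ->
  \sum_(Q <- cube_list n | `[< Q `<=` B >]) vol Q = vol B.
Proof.
move=> kn kB; rewrite -big_filter.
pose F : {fset set X} := [fset Q in cube_list n | `[< (Q `<=` B)%classic >]]%fset.
transitivity (\sum_(Q <- F) vol Q).
  apply: perm_big; apply: uniq_perm; rewrite ?filter_uniq ?fset_uniq// => Q.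
  by rewrite mem_filter !inE /= andbC.
have FE Q : (Q \in F) = `[< cubes D n Q /\ Q `<=` B >].
  by rewrite !inE /= mem_cube_list asbool_and.
rewrite (@sum_vol_bigcup n); last by move=> Q /=; rewrite FE => /asboolP[].
congr (volume mu _); apply/seteqP; split => [x [Q /=]|x Bx].
  by rewrite FE => /asboolP[_]; apply.
have [Q nQ Qx] := cubes_cover D n x; exists Q => //=.
rewrite FE; apply/asboolP; split=> //.
by apply: (cubes_nested kn kB nQ); exists x.
Qed.

(** Since [b] is less than one, after a fixed number of further subdivisions
    the cube that contains the centre of [Q] is so small that it stays well
    inside the ball that [Q] contains. *)
Lemma inner_cube : exists l : nat, forall n Q, (0 < n)%N -> cubes D n Q ->
  exists2 B, cubes D (n + l) B & closure B `<=` Q°.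
Proof.
have c0 := dyadic_c1_gt0; have c'0 := dyadic_c1'_gt0.
have [l Hl] : exists N, forall n, (N <= n)%N ->
    b ^+ n < dyadic_c1 b / (2 * dyadic_c1' b).
  by apply: expr_eventually_lt; rewrite ?b_lt1 ?andbT ?(ltW b_gt0)// divr_gt0// mulr_gt0.
exists l => -[//|n] Q _ [i iD QE].
have [] := dy_ball iD; rewrite QE -exprnP.
set x := dy_center _ _ _ => xQ _.
have [B nB Bx] := cubes_cover D (n.+1 + l) x; exists B => //.
have [j jD BE] : (dy_cube D (n.+1 + l)%:Z @` dy_index D (n.+1 + l)%:Z) B by [].
have [_] := dy_ball jD; rewrite BE -exprnP => By.
set r := dyadic_c1' b * b ^+ (n.+1 + l) in By.
have Bcb : B `<=` cball x (r + r).
  move=> z Bz; rewrite /cball /=; have /= Hx := By _ Bx; have /= Hz := By _ Bz.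
  apply: (le_trans (metric_triangle x (dy_center D (n.+1 + l)%:Z j) z)).
  by rewrite lerD// metric_sym.
apply: (@subset_trans _ (cball x (r + r))).
  have /closure_id -> := @cball_closed R X x (r + r); exact: closureS.
apply: (@subset_trans _ (ball x (dyadic_c1 b * b ^+ n.+1))); last first.
  by rewrite -open_subsetE//; exact: ball_open_mdist.
move=> z; rewrite /cball ballEmdist /= => /le_lt_trans; apply.
have c'20 : 0 < 2 * dyadic_c1' b by apply: mulr_gt0.
have := Hl l (leqnn l); rewrite (ltr_pdivlMr _ _ c'20) => H.
rewrite /r exprD (_ : _ + _ = b ^+ l * (2 * dyadic_c1' b) * b ^+ n.+1); last ring.
by rewrite ltr_pM2r// exprn_gt0.
Qed.

End cube_volume.

(** * The Hausdorff dimension *)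

Section hausdorff_dimension.
Context {R : realType} {X : pmetricType R} {s b : R}.
Variables (mu : probability (borel X) R) (D : dyadic_cubes X b).
Hypothesis s_gt0 : 0 < s.
Hypothesis X_nontrivial : exists x y : X, x <> y.
Hypothesis mu_regular : ahlfors_regular mu s.
Hypothesis b_bounds : 0 < b < 1 / 3.

(** Points carry no mass, by the upper regularity estimate at small radii. *)
Lemma point_mass0 (x : X) : mu (cball x 0) = 0%E.
Proof.
have [K K0 [KU _]] := ball_growth s_gt0 X_nontrivial mu_regular.
apply/eqP; rewrite eq_le measure_ge0 andbT.
apply/lee_addgt0Pr => e e0; rewrite add0e.
have eK0 : 0 < e / K by rewrite divr_gt0.
pose r := (e / K) `^ s^-1; have r0 : 0 < r by apply: powR_gt0.
apply: (@le_trans _ _ (mu (ball x r))).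
  apply: le_measure; [by apply: mem_set; apply: cball_borel| |].
    by apply: mem_set; apply: ball_borel.
  by move=> y; rewrite /cball ballEmdist /= => /le_lt_trans; apply.
apply: (le_trans (KU x r r0)).
rewrite lee_fin /r -powRrM mulVf ?gt_eqF// powRr1 ?(ltW eK0)//.
by rewrite mulrCA divff ?gt_eqF// mulr1.
Qed.

(** A set of diameter [r] lies in a ball of radius [2r], so its measure is
    controlled by the [t]-th power of its diameter for every [t] below [s]. *)
Lemma small_set_hull t : 0 < t -> t < s -> exists2 L : R, 0 < L &
  forall C : set X, (diam C <= 1)%E ->
  exists B : set X, [/\ measurable (B : set (borel X)), C `<=` B &
    (mu B <= L%:E * diam C `^ t)%E].
Proof.
move=> t0 ts.
have [K K0 [KU _]] := ball_growth s_gt0 X_nontrivial mu_regular.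
have L0 : 0 < K * 2 `^ s by rewrite mulr_gt0// powR_gt0.
exists (K * 2 `^ s) => // C C1.
have [->|/set0P[x Cx]] := eqVneq C set0.
  exists set0; split => //; rewrite measure0 mule_ge0 ?poweR_ge0//.
  by rewrite lee_fin ltW.
have Cfin : diam C \is a fin_num.
  by rewrite ge0_fin_numE ?diam_ge0// (le_lt_trans C1)// ltry.
pose r := fine (diam C); have rE : diam C = r%:E by rewrite fineK.
have r0 : 0 <= r by rewrite -lee_fin -rE diam_ge0.
have r1 : r <= 1 by rewrite -lee_fin -rE.
exists (cball x r); split; first exact: cball_borel.
  by move=> y Cy; rewrite /cball /= -lee_fin -rE; exact: mdist_le_diam.
rewrite rE poweR_EFin -EFinM.
have [r_eq0|rn0] := eqVneq r 0.
  by rewrite r_eq0 point_mass0 powR0 ?gt_eqF// mulr0.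
have r_gt0 : 0 < r by rewrite lt_neqAle eq_sym rn0.
have r20 : 0 < 2 * r by rewrite mulr_gt0.
apply: (@le_trans _ _ (mu (ball x (2 * r)))).
  apply: le_measure; [by apply: mem_set; apply: cball_borel| |].
    by apply: mem_set; apply: ball_borel.
  move=> y; rewrite /cball ballEmdist /= => /le_lt_trans; apply.
  by rewrite ltr_pMl// ltr1n.
apply: (le_trans (KU x _ r20)).
rewrite lee_fin powRM// mulrA ler_pM2l// ger_powR ?r_gt0// ltW//.
Qed.

(** The mass distribution principle: a cover by sets of diameter at most one
    must have a total cost comparable to the total mass. *)
Lemma hausdorff_measure_gt0 t : 0 < t -> t < s ->
  (0 < hausdorff_measure t [set: X])%E.
Proof.
move=> t0 ts; have [L L0 HL] := small_set_hull t0 ts.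
apply: (@lt_le_trans _ _ (hausdorff_content t 1 [set: X])); last first.
  by apply: ereal_sup_ubound; exists 1 => //=.
apply: (@lt_le_trans _ _ (L^-1)%:E); first by rewrite lte_fin invr_gt0.
apply: le_ereal_inf_tmp => _ [C [XC C1] <-].
have /choice[B HB] : forall i, exists B : set X,
    [/\ measurable (B : set (borel X)), C i `<=` B &
    (mu B <= L%:E * diam (C i) `^ t)%E] by move=> i; exact: HL.
have XB : [set: X] `<=` \bigcup_i B i.
  by move=> x /XC[i _ Cx]; exists i => //; have [_ + _] := HB i; apply.
have : (mu [set: X] <= \sum_(0 <= i <oo) mu (B i))%E.
  apply: measure_sigma_subadditive => //; first by move=> i; have [] := HB i.
rewrite probability_setT => H.
have {}H : (1 <= L%:E * \sum_(0 <= i <oo) diam (C i) `^ t)%E.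
  rewrite -nneseriesZl; last by move=> *; exact: poweR_ge0.
    apply: (le_trans H); apply: lee_nneseries => [i _ _|i _]; first exact: measure_ge0.
    by have [] := HB i.
by rewrite -(@lee_pmul2l _ L%:E) ?lte_fin// -EFinM divff ?gt_eqF.
Qed.

Lemma cube_diam n Q : cubes D n.+1 Q ->
  (diam Q <= (2 * dyadic_c1' b * b ^+ n.+1)%:E)%E.
Proof.
have b0 : 0 < b by case/andP: b_bounds.
have c'0 := dyadic_c1'_gt0 b_bounds.
move=> [i iD <-]; have [_] := dy_ball iD; rewrite -exprnP => Qi.
have c20 : 0 < 2 * dyadic_c1' b by apply: mulr_gt0.
apply: diam_le; first exact: (mulr_ge0 (ltW c20) (exprn_ge0 _ (ltW b0))).
move=> x y /Qi; rewrite /cball /= => xi /Qi; rewrite /cball /= => yi.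
apply: (le_trans (metric_triangle x (dy_center D n.+1%:Z i) y)).
by rewrite -mulrA mulrDl !mul1r lerD// metric_sym.
Qed.

(** For [t > s], the [t]-th power of the diameter of a cube is a multiple of
    its volume that vanishes as the level grows, and the volumes of the cubes
    of one level add up to one. *)
Lemma hausdorff_measure_eq0 t : s < t -> hausdorff_measure t [set: X] = 0%E.
Proof.
move=> st; have t0 : 0 < t by apply: lt_trans st.
have [K K0 HK] := cube_growth D s_gt0 X_nontrivial mu_regular b_bounds.
have b0 : 0 < b by case/andP: b_bounds.
have b1 : b < 1 by case/andP: b_bounds; lra.
have c'0 := dyadic_c1'_gt0 b_bounds.
pose c := 2 * dyadic_c1' b; have c0 : 0 < c by apply: mulr_gt0.
pose L := c `^ t * K; have L0 : 0 < L by rewrite mulr_gt0 ?powR_gt0.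
pose a := b `^ (t - s).
have a0 : 0 < a by rewrite powR_gt0.
have a1 : a < 1.
  by rewrite /a /powR gt_eqF// expR_lt1 pmulr_rlt0 ?subr_gt0// ln_lt0// b0 b1.
apply/eqP; rewrite eq_le; apply/andP; split; last first.
  apply: (@le_trans _ _ (hausdorff_content t 1 [set: X])).
    by apply: le_ereal_inf_tmp => _ [C _ <-]; apply: nneseries_ge0 => *; exact: poweR_ge0.
  by apply: ereal_sup_ubound; exists 1 => //=.
apply: ge_ereal_sup => _ [e /= e0 <-].
apply/lee_addgt0Pr => eta eta0; rewrite add0e.
have [N1 HN1] : exists N, forall n, (N <= n)%N -> b ^+ n < e / c.
  by apply: expr_eventually_lt; rewrite ?divr_gt0// (ltW b0).
have [N2 HN2] : exists N, forall n, (N <= n)%N -> a ^+ n < eta / L.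
  by apply: expr_eventually_lt; rewrite ?divr_gt0// (ltW a0).
pose n := maxn N1 N2.
have bn : c * b ^+ n.+1 <= e.
  have := HN1 n.+1 (leq_trans (leq_maxl N1 N2) (leqnSn _)).
  by rewrite ltr_pdivlMr// mulrC => /ltW.
have an : L * a ^+ n.+1 <= eta.
  have := HN2 n.+1 (leq_trans (leq_maxr N1 N2) (leqnSn _)).
  by rewrite ltr_pdivlMr// mulrC => /ltW.
pose C i := if i \in dy_index D n.+1 then dy_cube D n.+1 i else set0.
have Ci i : C i = set0 \/ cubes D n.+1 (C i).
  by rewrite /C; case: ifPn => [/set_mem iD|_]; [right; exists i|left].
have mC i : measurable (C i : set (borel X)).
  by have [->|/cube_borel//] := Ci i; exact: measurable0.
have d0 : diam (set0 : set X) = 0%E.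
  by apply/eqP; rewrite eq_le diam_ge0 andbT; apply: diam_le.
have tC : trivIset setT C.
  move=> i j _ _ [x []]; rewrite /C.
  case: ifPn => // /set_mem iD xi; case: ifPn => // /set_mem jD xj.
  apply/eqP/negPn/negP => ij; have := dy_disjoint iD jD ij.
  by move=> E; have : set0 x by rewrite -E.
apply: (@le_trans _ _ (\sum_(0 <= i <oo) (diam (C i) `^ t))%E).
  apply: ereal_inf_lbound; exists C => //; split.
    rewrite -(dy_cover D n.+1%:Z) => x [i iD xi]; exists i => //.
    by rewrite /C mem_set.
  move=> i; have [->|/cube_diam/le_trans] := Ci i.
    by rewrite d0 lee_fin ltW.
  by apply; rewrite lee_fin.
apply: (@le_trans _ _ (\sum_(0 <= i <oo) (eta%:E * mu (C i)))%E).
  apply: lee_nneseries => [i _ _|i _]; first exact: poweR_ge0.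
  have [->|iQ] := Ci i.
    by rewrite d0 measure0 mule0 poweR0r// gt_eqF.
  apply: (@le_trans _ _ ((c * b ^+ n.+1) `^ t)%:E).
    have cb0 : 0 <= c * b ^+ n.+1 by rewrite mulr_ge0 ?exprn_ge0// ltW.
    rewrite -poweR_EFin; apply: gt0_ler_poweR; rewrite ?(ltW t0)// ?in_itv/= ?leey ?andbT.
    - exact: diam_ge0.
    - by rewrite lee_fin.
    - exact: cube_diam iQ.
  rewrite (cube_volE mu iQ) -EFinM lee_fin.
  apply: le_trans (_ : eta * (K^-1 * (b `^ s) ^+ n.+1) <= _); last first.
    by rewrite ler_pM2l//; have /andP[] := HK _ _ iQ.
  apply: le_trans (_ : (L * a ^+ n.+1) * (K^-1 * (b `^ s) ^+ n.+1) <= _); last first.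
    by rewrite ler_pM2r// mulr_gt0 ?invr_gt0// exprn_gt0// powR_gt0.
  rewrite powRM ?exprn_ge0 ?(ltW c0) ?(ltW b0)// powR_exprn ?(ltW b0)//.
  rewrite /L [X in _ <= X](_ : _ = c `^ t * (K / K) * (a ^+ n.+1 * (b `^ s) ^+ n.+1)); last ring.
  rewrite divff ?gt_eqF// mulr1 -exprMn /a -powRD ?subrK//.
  by rewrite (gt_eqF b0) implybT.
rewrite nneseriesZl; last by move=> *; exact: measure_ge0.
rewrite -{2}(mule1 eta%:E) lee_pmul2l// ?lte_fin//.
have -> : (\sum_(0 <= i <oo) mu (C i) = mu (\bigcup_i C i))%E.
  by rewrite measure_bigcup//; apply: eq_eseriesl => i; rewrite in_setT.
by apply: probability_le1; apply: bigcup_measurable => i _; exact: mC.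
Qed.

Theorem hausdorff_dim_regular : hausdorff_dim [set: X] = s%:E.
Proof.
apply/eqP; rewrite eq_le; apply/andP; split.
  apply/lee_addgt0Pr => e e0; apply: ereal_inf_lbound; exists (s + e) => //=.
  by split; [rewrite addr_gt0|rewrite hausdorff_measure_eq0// ltrDl].
apply: le_ereal_inf_tmp => _ [t /= [t0 tX] <-]; rewrite lee_fin leNgt.
by apply/negP => ts; have := hausdorff_measure_gt0 t0 ts; rewrite tX ltxx.
Qed.

End hausdorff_dimension.

(** * Cubes that are covered too cheaply *)

Section esum_facts.
Context {R : realType} {T : choiceType}.
Implicit Types (A B : set T) (f : T -> \bar R).
Local Open Scope ereal_scope.

Lemma sum_fset_le_esum (F : {fset T}) A f : [set` F] `<=` A ->
  \sum_(x <- F) f x <= \esum_(x in A) f x.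
Proof.
move=> FA; apply: esum_ge; exists [set` F]; first by split.
by rewrite fsbig_finite//= set_fsetK.
Qed.

Lemma esum_subset A B f : A `<=` B ->
  \esum_(x in A) f x <= \esum_(x in B) f x.
Proof.
move=> AB; apply: ge_ereal_sup => _ [F [finF FA] <-].
by apply: esum_ge; exists F => //; split => //; exact: subset_trans AB.
Qed.

Lemma ge_term_esum A f x : A x -> f x <= \esum_(y in A) f y.
Proof.
move=> Ax; have := @sum_fset_le_esum [fset x]%fset A f.
by rewrite big_seq_fset1; apply => y /=; rewrite inE => /eqP ->.
Qed.

End esum_facts.

(** The arithmetic-geometric inequality for [th * a] and [x ^+ 2 / (th * a)].
    Summed over cubes with [a = vol B `^ p], it plays the role of the
    Cauchy-Schwarz inequality. *)
Lemma norm_le_mean {R : realType} (x a th : R) : 0 < a -> 0 < th ->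
  `|x| <= 2^-1 * (th * a + th^-1 * (a^-1 * x ^+ 2)).
Proof.
move=> a0 th0.
have ta0 : 0 < th * a by rewrite mulr_gt0.
rewrite mulrA -invfM -(ler_pM2r ta0) -mulrA mulrDl.
rewrite [_^-1 * _ * _](_ : _ = x ^+ 2); last by rewrite mulrAC mulVf ?mul1r ?gt_eqF.
rewrite -real_normK ?num_real//; have := sqr_ge0 (th * a - `|x|); nra.
Qed.

Section under_covered_cubes.
Context {R : realType} {X : pmetricType R} {s b : R}.
Variables (mu : probability (borel X) R) (D : dyadic_cubes X b).
Hypothesis s_gt0 : 0 < s.
Hypothesis X_nontrivial : exists x y : X, x <> y.
Hypothesis mu_regular : ahlfors_regular mu s.
Hypothesis b_bounds : 0 < b < 1 / 3.
Implicit Types (n k : nat) (Q B : set X) (a : set X -> R).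

Local Notation vol := (volume mu).

Definition cubes_upto n : {fset set X} :=
  fset_set (\bigcup_(k in `I_n.+1) cubes D k).

Lemma mem_cubes_upto n B :
  reflect (exists2 k, (k <= n)%N & cubes D k B) (B \in cubes_upto n).
Proof.
rewrite in_fset_set; last first.
  apply: bigcup_finite; first exact: finite_II.
  by move=> k _; exact: (finite_cubes D s_gt0 X_nontrivial mu_regular b_bounds).
apply: (iffP idP) => [/set_mem[k /= kn kB]|[k kn kB]]; first by exists k.
by apply: mem_set; exists k.
Qed.

Definition mass_in a n B : R := \sum_(Q <- cube_list D n | `[< Q `<=` B >]) a Q.

(** A discrete form of the Riesz energy, of exponent [p * s], of the signed
    measure that is the difference between the weights and the volume. *)
Definition discrepancy (p : R) a n : R :=
  \sum_(B <- cubes_upto n) (vol B `^ p)^-1 * (mass_in a n B - vol B) ^+ 2.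

(** In the probabilistic part the levels at which this holds depend on the
    outcome; the proof of the lower bound on the content only ever needs one
    such level at a time, chosen after the cover has been fixed. *)
Definition regular_weights (p C1 : R) (w : nat -> set X -> R) : Prop :=
  forall (zeta : R) N, 0 < zeta -> exists n, [/\ (N <= n)%N,
    forall B, cubes D n B -> w n B <= C1 * vol B `^ p &
    discrepancy p (w n) n <= zeta].

Definition meeting (C : set (set X)) Q : set (set X) :=
  [set B | C B /\ B `&` Q !=set0].

(** Each cube of [C] that meets [Q] is counted in full, even if it is larger
    than [Q]; hence no cube of [C] contains an under-covered cube. *)
Definition under_covered (p : R) (C : set (set X)) Q : Prop :=
  (\esum_(B in meeting C Q) (vol B `^ p)%:E < (vol Q `^ p)%:E)%E.

Variable p : R.
Hypothesis p_bounds : 0 < p < 1.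

Let p_gt0 : 0 < p. Proof. by case/andP: p_bounds. Qed.
Let p_lt1 : p < 1. Proof. by case/andP: p_bounds. Qed.

Let vol_gt0 := @vol_gt0 _ _ _ _ mu D s_gt0 X_nontrivial mu_regular b_bounds.

Let volp_gt0 n Q : cubes D n Q -> 0 < vol Q `^ p.
Proof. by move=> /vol_gt0 ?; apply: powR_gt0. Qed.

Let volp_le1 n Q : cubes D n Q -> vol Q `^ p <= 1.
Proof.
move=> nQ; rewrite -[leRHS](_ : 1 `^ p = 1); last by rewrite powR1.
by rewrite ge0_ler_powR ?nnegrE ?vol_ge0 ?(ltW p_gt0)// (vol_le1 mu nQ).
Qed.

Variable C : set (set X).
Hypothesis C_cubes : C `<=` all_cubes D.

Lemma meeting_cube Q B : meeting C Q B -> exists k, cubes D k B.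
Proof. by move=> [/C_cubes[k _ kB] _]; exists k. Qed.

Lemma meeting_sub m Q B : cubes D m Q -> under_covered p C Q ->
  meeting C Q B -> B `<=` Q.
Proof.
move=> mQ Qu QB; have [k kB] := meeting_cube QB.
have [km|/ltnW mk] := leqP k m; last first.
  by apply: (cubes_nested mk mQ kB); have [_ [x [? ?]]] := QB; exists x.
have QsubB : Q `<=` B by apply: (cubes_nested km kB mQ); case: QB.
have := le_lt_trans (@ge_term_esum _ _ _ (fun B => (vol B `^ p)%:E) _ QB) Qu.
rewrite lte_fin ltNge ge0_ler_powR ?nnegrE ?vol_ge0 ?(ltW p_gt0)//.
exact: vol_le kB mQ QsubB.
Qed.

(** Since [p < 1], a small [p]-th power sum forces a small sum of volumes. *)
Lemma vol_meeting_le m Q B : cubes D m Q -> under_covered p C Q ->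
  meeting C Q B -> vol B <= vol B `^ p * vol Q `^ (1 - p).
Proof.
move=> mQ Qu QB; have [k kB] := meeting_cube QB.
have vB := vol_gt0 kB.
rewrite -{1}(powRr1 (ltW vB)) -{1}(subrKC p 1) powRD; last first.
  by rewrite (gt_eqF vB) implybT.
rewrite ler_pM2l ?powR_gt0// ge0_ler_powR ?nnegrE ?vol_ge0 ?subr_ge0 ?(ltW p_lt1)//.
exact: vol_le mQ kB (meeting_sub mQ Qu QB).
Qed.

(** Each cube of [C] appears at some level, and the sum over [C] converges, so
    the cubes of [C] not yet seen at level [n] become negligible. *)
Lemma unseen_cubes_small Q eta : under_covered p C Q -> 0 < eta ->
  exists N, forall n, (N <= n)%N ->
  (\esum_(B in meeting C Q `\` [set` cubes_upto n]) (vol B `^ p)%:E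
     <= eta%:E)%E.
Proof.
move=> Qu eta0; set f := fun B => (vol B `^ p)%:E.
have f0 B : (0 <= f B)%E by rewrite lee_fin powR_ge0.
have Sfin : (\esum_(B in meeting C Q) f B)%E \is a fin_num.
  by rewrite ge0_fin_numE ?esum_ge0// (lt_trans Qu)// ltry.
have [_ [F [finF FC] <-] HF] := ub_ereal_sup_adherent eta0 Sfin.
have /choice[lv Hlv] : forall B, exists k, F B -> cubes D k B.
  move=> B; have [FB|nFB] := pselect (F B); last by exists 0%N.
  by have [k kB] := meeting_cube (FC _ FB); exists k.
exists (\max_(B <- fset_set F) lv B)%N => n Nn.
have Fn : F `<=` [set` cubes_upto n].
  move=> B FB; apply/mem_cubes_upto; exists (lv B); last exact: Hlv.
  apply: leq_trans Nn; apply: leq_bigmax_seq => //.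
  by rewrite in_fset_set//; exact: mem_set.
have := HF; rewrite -/(esum _ _) (esumID [set` cubes_upto n]); last by move=> B _; exact: f0.
move=> H.
have {H} : (\esum_(B in meeting C Q `&` [set` cubes_upto n]) f B +
   \esum_(B in meeting C Q `&` ~` [set` cubes_upto n]) f B - eta%:E <=
   \esum_(B in meeting C Q `&` [set` cubes_upto n]) f B)%E.
  apply: (le_trans (ltW H)); apply: esum_ge; exists F => //; split => //.
  by move=> B FB; split; [exact: FC|exact: Fn].
rewrite setDE; set u := esum _ _; set v := esum _ _.
have ufin : u \is a fin_num.
  rewrite ge0_fin_numE ?esum_ge0//; apply: (@le_lt_trans _ _ (\esum_(B in meeting C Q) f B)%E).
    by apply: esum_subset => B [].
  by rewrite (lt_trans Qu)// ltry.
by rewrite leeBlDr// leeD2lE.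
Qed.


Lemma mass_inE n a k B : (k <= n)%N -> cubes D k B ->
  mass_in a n B - vol B =
  \sum_(Q <- cube_list D n | `[< Q `<=` B >]) (a Q - vol Q).
Proof.
move=> kn kB; rewrite sumrB; congr (_ - _).
by rewrite (sum_vol_subcubes s_gt0 X_nontrivial mu_regular b_bounds kn kB).
Qed.

Let mem_cubes n Q : (Q \in cube_list D n) = `[< cubes D n Q >].
Proof. exact: (mem_cube_list D s_gt0 X_nontrivial mu_regular b_bounds). Qed.

(** Cubes of one level are disjoint, so at most one term is nonzero. *)
Lemma sum_supercubes n k B (y : \bar R) : cubes D k B -> (0 <= y)%E ->
  (\sum_(Q <- cube_list D n) (if `[< B `<=` Q >] then y else 0) <= y)%E.
Proof.
move=> kB y0.
have [[Q0 [nQ0 BQ0]]|noQ] := pselect (exists Q, cubes D n Q /\ B `<=` Q).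
  rewrite (bigD1_seq Q0) ?fset_uniq//=; last by rewrite mem_cubes; apply/asboolP.
  rewrite big_seq_cond big1 ?adde0; first by case: ifP.
  move=> Q /andP[]; rewrite mem_cubes => /asboolP nQ /eqP QQ0.
  case: asboolP => // BQ; exfalso; apply: QQ0; apply: (cubes_disjoint nQ nQ0).
  have [x Bx] := cube_neq0 s_gt0 X_nontrivial mu_regular b_bounds kB.
  by exists x; split; [exact: BQ|exact: BQ0].
rewrite big_seq big1// => Q; rewrite mem_cubes => /asboolP nQ.
by case: asboolP => // BQ; exfalso; apply: noQ; exists Q.
Qed.

Lemma sum_volp_le_esum n Q :
  ((\sum_(B <- cubes_upto n | `[< meeting C Q B >]) vol B `^ p)%:E <=
   \esum_(B in meeting C Q) (vol B `^ p)%:E)%E.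
Proof.
pose F : {fset set X} := [fset B in cubes_upto n | `[< meeting C Q B >]]%fset.
rewrite -sumEFin -big_filter.
rewrite (perm_big F); last first.
  apply: uniq_perm; rewrite ?filter_uniq ?fset_uniq// => B.
  by rewrite mem_filter !inE /= andbC.
by apply: sum_fset_le_esum => B /=; rewrite !inE /= => /andP[_ /asboolP].
Qed.

Lemma sum_volp_le n Q : under_covered p C Q ->
  \sum_(B <- cubes_upto n | `[< meeting C Q B >]) vol B `^ p <= vol Q `^ p.
Proof. by move=> /ltW Qu; rewrite -lee_fin (le_trans (sum_volp_le_esum _ _)). Qed.

(** If none of the cubes of level [n] that carry weight inside [Q] had an
    under-covered inner cube, then every one of them would be covered either
    by a cube of [C] already seen at level [n] or, at a cost comparable to its
    weight, by cubes of [C] not yet seen. *)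
Lemma mass_le_cover m n l Q a (c C1 eta : R) :
  0 < c -> 0 <= C1 -> (forall B, 0 <= a B) ->
  cubes D m Q -> under_covered p C Q -> (m <= n)%N ->
  (forall B, cubes D n B -> a B <= C1 * vol B `^ p) ->
  (forall B, cubes D n B -> exists Q'', [/\ cubes D (n + l) Q'', Q'' `<=` B &
     c * vol B `^ p <= vol Q'' `^ p] /\
     (B `<=` Q -> 0 < a B -> ~ under_covered p C Q'')) ->
  (\esum_(B in meeting C Q `\` [set` cubes_upto n]) (vol B `^ p)%:E
     <= eta%:E)%E ->
  mass_in a n Q <=
    \sum_(B <- cubes_upto n | `[< meeting C Q B >]) mass_in a n B
    + C1 / c * eta.
Proof.
move=> c0 C10 a0 mQ Qu mn aC1 inner Heta.
set A := (meeting C Q `\` [set` cubes_upto n]) in Heta.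
pose g B : \bar R := (vol B `^ p)%:E.
have g0 B : (0 <= g B)%E by rewrite lee_fin powR_ge0.
pose T B := (\esum_(B' in A) (if `[< B' `<=` B >] then g B' else 0))%E.
have ite0 B B' : (0 <= if `[< B' `<=` B >] then g B' else 0)%E by case: ifP.
have T0 B : (0 <= T B)%E by apply: esum_ge0 => B' _; exact: ite0.
have AA B : A B -> exists k, cubes D k B.
  by move=> -[/meeting_cube].
have sumT : (\sum_(B <- cube_list D n) T B <= eta%:E)%E.
  rewrite /T -esum_sum; last by move=> *; exact: ite0.
  apply: le_trans Heta; apply: le_esum => B /AA[k kB].
  exact: (sum_supercubes n kB).
have Tfin B : cubes D n B -> T B \is a fin_num.
  move=> nB; rewrite ge0_fin_numE//; apply: (@le_lt_trans _ _ eta%:E); last by rewrite ltry.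
  apply: le_trans sumT; rewrite (bigD1_seq B) ?fset_uniq//=; last first.
    by rewrite mem_cubes; apply/asboolP.
  by rewrite leeDl// sume_ge0.
have claim B : cubes D n B -> B `<=` Q ->
    a B <= \sum_(B' <- cubes_upto n | `[< meeting C Q B' >])
             (if `[< B `<=` B' >] then a B else 0) + C1 / c * fine (T B).
  move=> nB BQ.
  have S0 : 0 <= \sum_(B' <- cubes_upto n | `[< meeting C Q B' >])
             (if `[< B `<=` B' >] then a B else 0).
    by apply: sumr_ge0 => B' _; case: ifP.
  have cT0 : 0 <= C1 / c * fine (T B).
    by rewrite mulr_ge0 ?fine_ge0// divr_ge0// ltW.
  have [[B' [B'n B'Q BB']]|noB'] := pselect (exists B',
      [/\ B' \in cubes_upto n, meeting C Q B' & B `<=` B']).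
    rewrite big_mkcond (bigD1_seq B') ?fset_uniq//=.
    rewrite (asboolT BB') (asboolT B'Q) -addrA lerDl addr_ge0//.
    by apply: sumr_ge0 => B'' _; case: ifP => // _; case: ifP.
  have [aB|] := ltP 0 (a B); last by move=> /le_trans; apply; rewrite addr_ge0.
  have [Q'' [[nQ'' Q''B cB] /(_ BQ aB) Q''u]] := inner B nB.
  apply: (@le_trans _ _ (C1 / c * fine (T B))); last by rewrite lerDr.
  apply: (le_trans (aC1 B nB)); rewrite -mulrA ler_wpM2l//.
  rewrite mulrC ler_pdivlMr// mulrC (le_trans cB)//.
  rewrite -lee_fin fineK ?Tfin//.
  move/negP: Q''u; rewrite -leNgt => /le_trans; apply.
  apply: (@le_trans _ _ (\esum_(B' in meeting C Q'')
     (if `[< B' `<=` B >] then g B' else 0))%E); last first.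
    apply: esum_subset => B' [CB' B'Q''].
    split.
      split=> //; have [x [? ?]] := B'Q''; exists x; split => //.
      by apply: BQ; exact: Q''B.
    move=> /= B'n; apply: noB'; exists B'; split => //.
      split=> //; have [x [? ?]] := B'Q''; exists x; split => //.
      by apply: BQ; exact: Q''B.
    have /mem_cubes_upto[k kn kB'] := B'n.
    apply: (cubes_nested kn kB' nB); have [x [? ?]] := B'Q''; exists x.
    by split => //; exact: Q''B.
  apply: le_esum => B' [CB' B'Q'']; case: asboolP => // B'B; exfalso; apply: B'B.
  have [x [B'x Q''x]] := B'Q''.
  have [k kB'] := meeting_cube (conj CB' B'Q'').
  have [kn|/ltnW nk] := leqP k n; last first.
    by apply: (cubes_nested nk nB kB'); exists x; split => //; exact: Q''B.
  exfalso; apply: noB'; exists B'; split.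
  - by apply/mem_cubes_upto; exists k.
  - by split=> //; exists x; split => //; apply: BQ; exact: Q''B.
  - by apply: (cubes_nested kn kB' nB); exists x; split => //; exact: Q''B.
rewrite {1}/mass_in.
apply: (@le_trans _ _ (\sum_(B <- cube_list D n | `[< B `<=` Q >])
   (\sum_(B' <- cubes_upto n | `[< meeting C Q B' >])
             (if `[< B `<=` B' >] then a B else 0) + C1 / c * fine (T B)))).
  rewrite big_seq_cond [X in _ <= X]big_seq_cond; apply: ler_sum => B /andP[].
  by rewrite mem_cubes => /asboolP nB /asboolP BQ; exact: claim.
rewrite big_split /= lerD//.
  rewrite exchange_big /=; apply: ler_sum => B _; rewrite /mass_in -big_mkcondr /=.
  rewrite big_mkcond [X in _ <= X]big_mkcond; apply: ler_sum => Q' _.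
  by case: asboolP; case: asboolP => //=.
rewrite -mulr_sumr ler_wpM2l ?divr_ge0 ?(ltW c0)//.
rewrite big_seq_cond sum_fine /=; last first.
  by move=> B /andP[]; rewrite mem_cubes => /asboolP nB _; exact: Tfin.
rewrite -lee_fin fineK; last first.
  by apply/sum_fin_numP => B _ /andP[]; rewrite mem_cubes => /asboolP nB _; exact: Tfin.
apply: le_trans sumT; rewrite -big_seq_cond [X in (X <= _)%E]big_mkcond.
by apply: lee_sum => B _; case: ifP.
Qed.


Lemma discrepancy_term_ge0 a n B :
  0 <= (vol B `^ p)^-1 * (mass_in a n B - vol B) ^+ 2.
Proof. by rewrite mulr_ge0 ?sqr_ge0// invr_ge0 powR_ge0. Qed.

Lemma sum_deviation_le m n Q a (th : R) : 0 < th ->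
  cubes D m Q -> under_covered p C Q ->
  \sum_(B <- cubes_upto n | `[< meeting C Q B >]) `|mass_in a n B - vol B| <=
  2^-1 * (th + th^-1 * discrepancy p a n).
Proof.
move=> th0 mQ Qu.
apply: (@le_trans _ _ (\sum_(B <- cubes_upto n | `[< meeting C Q B >])
  2^-1 * (th * vol B `^ p
    + th^-1 * ((vol B `^ p)^-1 * (mass_in a n B - vol B) ^+ 2)))).
  apply: ler_sum => B /asboolP/meeting_cube[k kB].
  by apply: norm_le_mean => //; exact: volp_gt0 kB.
rewrite -mulr_sumr ler_pM2l ?invr_gt0// big_split /= lerD//; last first.
  rewrite -mulr_sumr ler_pM2l ?invr_gt0// big_mkcond; apply: ler_sum => B _.
  by case: ifP => // _; exact: discrepancy_term_ge0.
rewrite -mulr_sumr -[X in _ <= X]mulr1 ler_pM2l//.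
apply: le_trans (sum_volp_le n Qu) _.
exact: volp_le1 mQ.
Qed.

(** A cube that is too cheaply covered by [C] contains, at some arbitrarily
    high level [n], a cube carrying weight whose inner cube is again too
    cheaply covered. Otherwise the weight inside [Q], which is nearly the
    volume of [Q], would be bounded by the weight of the cubes of [C] seen at
    level [n], nearly their volume, plus an error that vanishes with the cost
    of the unseen cubes; but the total volume of the cubes of [C] in [Q] is
    smaller than that of [Q] by a fixed amount. *)
Lemma under_covered_descent m l Q (w : nat -> set X -> R) (c C1 : R) :
  0 < c -> 0 <= C1 -> (forall n B, 0 <= w n B) ->
  (forall n B, (0 < n)%N -> cubes D n B -> exists2 B', cubes D (n + l) B' &
     closure B' `<=` B° /\ c * vol B `^ p <= vol B' `^ p) ->
  regular_weights p C1 w ->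
  cubes D m Q -> under_covered p C Q ->
  exists n Q' Q'', [/\ (m < n)%N, cubes D n Q', 0 < w n Q' & Q' `<=` Q] /\
    [/\ cubes D (n + l) Q'', closure Q'' `<=` Q'° & under_covered p C Q''].
Proof.
move=> c0 C10 w0 inner wH mQ Qu.
have vQ := vol_gt0 mQ.
pose S := fine (\esum_(B in meeting C Q) (vol B `^ p)%:E)%E.
have SE : (\esum_(B in meeting C Q) (vol B `^ p)%:E)%E = S%:E.
  rewrite fineK// ge0_fin_numE; first by rewrite (lt_trans Qu)// ltry.
  by apply: esum_ge0 => B _; rewrite lee_fin powR_ge0.
have SQ : S < vol Q `^ p by rewrite -lte_fin -SE.
pose kap := vol Q - S * vol Q `^ (1 - p).
have kap0 : 0 < kap.
  have E : vol Q = vol Q `^ p * vol Q `^ (1 - p).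
    rewrite -powRD ?subrKC ?powRr1 ?(ltW vQ)//.
    by rewrite (gt_eqF vQ) implybT.
  by rewrite subr_gt0 [X in _ < X]E ltr_pM2r// powR_gt0.
(* kap is the volume of Q that C cannot cover; each of the three errors
   below is kept under a quarter of it *)
have th0 : 0 < kap / 4 by rewrite divr_gt0.
(* the summand 1 makes C2 positive even if C1 is zero *)
pose C2 := C1 / c + 1.
have C20 : 0 < C2 by rewrite ltr_pwDr// divr_ge0// ltW.
have [N0 HN0] := unseen_cubes_small Qu (divr_gt0 th0 C20).
have [n [Nn wC1 disc]] := wH ((kap / 4) ^+ 2) (maxn N0 m.+1) (exprn_gt0 _ th0).
have mn : (m < n)%N by apply: leq_trans Nn; rewrite leq_maxr.
have N0n : (N0 <= n)%N by apply: leq_trans Nn; rewrite leq_maxl.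
have n0 : (0 < n)%N by apply: leq_ltn_trans mn.
apply: contrapT => noQ.
have inner' B : cubes D n B -> exists Q'', [/\ cubes D (n + l) Q'', Q'' `<=` B &
     c * vol B `^ p <= vol Q'' `^ p] /\
     (B `<=` Q -> 0 < w n B -> ~ under_covered p C Q'').
  move=> nB; have [Q'' nQ'' [Q''B cB]] := inner n B n0 nB; exists Q''.
  split; first split=> //.
    by move=> x /subset_closure/Q''B; exact: interior_subset.
  by move=> BQ wB Q''u; apply: noQ; exists n, B, Q''.
have Hmass := mass_le_cover c0 C10 (w0 n) mQ Qu (ltnW mn) wC1 inner' (HN0 n N0n).
have dev := sum_deviation_le n (w n) th0 mQ Qu.
have volsum : \sum_(B <- cubes_upto n | `[< meeting C Q B >]) vol B <=
    S * vol Q `^ (1 - p).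
  apply: (@le_trans _ _ (\sum_(B <- cubes_upto n | `[< meeting C Q B >])
    vol B `^ p * vol Q `^ (1 - p))).
    by apply: ler_sum => B /asboolP; exact: vol_meeting_le mQ Qu.
  by rewrite -mulr_suml ler_wpM2r ?powR_ge0// -lee_fin -SE sum_volp_le_esum.
have Qn : Q \in cubes_upto n by apply/mem_cubes_upto; exists m => //; exact: ltnW.
have devQ : `|mass_in (w n) n Q - vol Q| <=
    2^-1 * (kap / 4 + (kap / 4)^-1 * discrepancy p (w n) n).
  apply: le_trans (norm_le_mean _ (volp_gt0 mQ) th0) _.
  rewrite ler_pM2l ?invr_gt0// lerD//.
    rewrite -[X in _ <= X]mulr1 ler_pM2l//.
    exact: volp_le1 mQ.
  rewrite ler_pM2l ?invr_gt0// /discrepancy (bigD1_seq Q) ?fset_uniq//= lerDl.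
  by apply: sumr_ge0 => B _; exact: discrepancy_term_ge0.
have discb : (kap / 4)^-1 * discrepancy p (w n) n <= kap / 4.
  by rewrite mulrC ler_pdivrMr// -expr2.
have C2b : C1 / c * (kap / 4 / C2) <= kap / 4.
  rewrite mulrCA ler_piMr ?(ltW th0)// ler_pdivrMr// mul1r /C2 lerDl//.
have massB : \sum_(B <- cubes_upto n | `[< meeting C Q B >]) mass_in (w n) n B <=
   \sum_(B <- cubes_upto n | `[< meeting C Q B >]) vol B +
   \sum_(B <- cubes_upto n | `[< meeting C Q B >]) `|mass_in (w n) n B - vol B|.
  by rewrite -big_split /=; apply: ler_sum => B _; rewrite -lerBlDl ler_norm.
have := ler_norm (vol Q - mass_in (w n) n Q); rewrite distrC.
move: kap0; rewrite /kap in discb dev devQ C2b Hmass *; lra.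
Qed.

End under_covered_cubes.

(** * Content of a limsup set carried by regular weights *)

Lemma esum_image_le {R : realType} {T T' : choiceType} (A : set T) (e : T -> T')
    (f : T' -> \bar R) :
  (\esum_(y in e @` A) f y <= \esum_(x in A) f (e x))%E.
Proof.
have [->|/set0P[x0 Ax0]] := eqVneq A set0.
  by rewrite image_set0 !esum_set0.
have /choice[g Hg] : forall y, exists x, (e @` A) y -> A x /\ e x = y.
  move=> y; have [[x Ax <-]|ny] := pselect ((e @` A) y); first by exists x.
  by exists x0.
have ginj : set_inj (e @` A) g.
  move=> y z /set_mem/Hg[_ gy] /set_mem/Hg[_ gz] gyz.
  by rewrite -gy -gz gyz.
have gA : g @` (e @` A) `<=` A by move=> _ [y /Hg[Ag _] <-].
apply: le_trans (esum_subset (fun x => f (e x)) gA).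
rewrite (esum_image _ g (fun x => f (e x)) ginj).
by apply: le_esum => y /Hg[_ ->].
Qed.

Section content_of_limsup.
Context {R : realType} {X : pmetricType R} {s b : R}.
Variables (mu : probability (borel X) R) (D : dyadic_cubes X b).
Hypothesis s_gt0 : 0 < s.
Hypothesis X_nontrivial : exists x y : X, x <> y.
Hypothesis mu_regular : ahlfors_regular mu s.
Hypothesis b_bounds : 0 < b < 1 / 3.
Hypothesis X_compact : compact [set: X].
Implicit Types (n k : nat) (Q B : set X).

Local Notation vol := (volume mu).

Lemma inner_cube_volp p : 0 < p -> exists l : nat, exists2 c : R, 0 < c &
  forall n B, (0 < n)%N -> cubes D n B -> exists2 B', cubes D (n + l) B' &
     closure B' `<=` B° /\ c * vol B `^ p <= vol B' `^ p.
Proof.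
move=> p0.
have [l Hl] := inner_cube D b_bounds.
have [K K0 HK] := cube_growth D s_gt0 X_nontrivial mu_regular b_bounds.
have bs0 : 0 < b `^ s by rewrite powR_gt0//; case/andP: b_bounds.
pose c := K^-1 * (b `^ s) ^+ l / K.
have c0 : 0 < c by rewrite divr_gt0// mulr_gt0 ?invr_gt0// exprn_gt0.
exists l, (c `^ p); first by rewrite powR_gt0.
move=> n B n0 nB; have [B' nB' B'B] := Hl n B n0 nB; exists B' => //; split => //.
rewrite -powRM ?vol_ge0 ?(ltW c0)//.
rewrite ge0_ler_powR ?nnegrE ?vol_ge0 ?(ltW p0)//.
  by rewrite mulr_ge0 ?vol_ge0// ltW.
have /andP[H _] := HK _ _ nB'; apply: le_trans H.
have /andP[_ H] := HK _ _ nB; rewrite exprD [_ ^+ n * _]mulrC mulrA /c.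
rewrite -[leLHS]mulrA ler_pM2l ?mulr_gt0 ?invr_gt0 ?exprn_gt0//.
by rewrite mulrC ler_pdivrMr// mulrC.
Qed.

Variables (w : nat -> set X -> R) (p C1 : R).
Hypothesis p_bounds : 0 < p < 1.
Hypothesis C1_ge0 : 0 <= C1.
Hypothesis w_ge0 : forall n B, 0 <= w n B.
Hypothesis w_regular : regular_weights mu D p C1 w.

(** Iterating the descent yields a decreasing sequence of cubes, each well
    inside a cube that carries weight. By compactness there is a point common
    to all of them; it lies in the limsup set, and it lies in no cube of [C],
    because such a cube would contain a cube of the sequence entirely. *)
Lemma uncovered_point (C : set (set X)) m Q : C `<=` all_cubes D ->
  cubes D m Q -> under_covered mu p C Q ->
  exists x : X, [/\ Q x,
    lim_sup_set (fun n => \bigcup_(B in [set B | cubes D n B /\ 0 < w n B]) B°) x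
    & forall B, C B -> ~ B x].
Proof.
move=> CD mQ Qu; have p0 : 0 < p by case/andP: p_bounds.
have [l [c c0 inner]] := inner_cube_volp p0.
pose T := {u : nat * set X | cubes D u.1 u.2 /\ under_covered mu p C u.2}.
pose step (u v : T) := exists n Q', [/\ ((sval u).1 < n <= (sval v).1)%N,
  cubes D n Q', 0 < w n Q', Q' `<=` (sval u).2 & closure (sval v).2 `<=` Q'°].
have step_ex (u : T) : {v : T | step u v}.
  apply: cid; case: u => -[k B] /= [kB Bu].
  have [n [Q' [Q'' [[kn nQ' wQ' Q'B] [nQ'' Q''Q' Q''u]]]]] :=
    under_covered_descent s_gt0 X_nontrivial mu_regular b_bounds p_bounds CD
      c0 C1_ge0 w_ge0 inner w_regular kB Bu.
  exists (exist _ (n + l, Q'')%N (conj nQ'' Q''u)).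
  by exists n, Q'; split => //=; rewrite kn leq_addr.
have [f [f0 fS]] := dependent_choice step_ex (exist _ (m, Q) (conj mQ Qu)).
pose lv k := (sval (f k)).1; pose cu k := (sval (f k)).2.
have fcu k : cubes D (lv k) (cu k) /\ under_covered mu p C (cu k).
  exact: svalP (f k).
have lvk k : (k <= lv k)%N.
  elim: k => // k IH; have [n [Q' [/andP[kn nk] _ _ _ _]]] := fS k.
  by apply: leq_trans nk; apply: leq_ltn_trans kn.
have cuS k : cu k.+1 `<=` cu k.
  have [n [Q' [_ _ _ Q'k kQ']]] := fS k.
  by move=> x /subset_closure/kQ'/interior_subset/Q'k.
have cuD k j : cu (k + j)%N `<=` cu k.
  elim: j => [|j IH]; first by rewrite addn0.
  by rewrite addnS; apply: subset_trans IH; exact: cuS.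
have /choice[y Hy] : forall k, exists x, cu k x.
  by move=> k; have [/(cube_neq0 s_gt0 X_nontrivial mu_regular b_bounds)] := fcu k.
have [x [_ xcl]] := X_compact (fmap_proper_filter y eventually_filter) filterT.
have clx k : closure (cu k) x.
  move=> B Bx; apply: xcl => //; exists k => // j /= kj.
  by rewrite -(subnKC kj); apply: cuD; exact: Hy.
have xstep k : exists n Q', [/\ (k < n)%N, cubes D n Q', 0 < w n Q',
     Q' `<=` cu k & Q'° x].
  have [n [Q' [/andP[kn nk] nQ' wQ' Q'k kQ']]] := fS k.
  exists n, Q'; split => //; first exact: leq_ltn_trans kn.
  by apply: kQ'; exact: clx.
have xcu k : cu k x.
  by have [n [Q' [_ _ _ + /interior_subset]]] := xstep k; apply.
exists x; split.
- by have := xcu 0%N; rewrite /cu f0.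
- move=> N _; have [n [Q' [/ltnW Nn nQ' wQ' _ xQ']]] := xstep N.
  by exists n => //; exists Q'.
- move=> B CB Bx; have [k _ kB] := CD _ CB.
  have [kk ku] := fcu k.
  have Bk : meeting C (cu k) B by split => //; exists x.
  have := meeting_sub p_bounds CD kk ku Bk.
  move: (@ge_term_esum _ _ _ (fun B => (vol B `^ p)%:E) _ Bk) => /le_lt_trans/(_ ku).
  rewrite lte_fin ltNge ge0_ler_powR ?nnegrE ?vol_ge0 ?(ltW p0)//.
  apply: (vol_le mu kB kk); apply: (cubes_nested (lvk k) kB kk).
  by exists x.
Qed.

(** The content of a cube is at most the cost of the cube itself, so it
    suffices that no cover of the intersection is cheaper. *)
Lemma cube_content_eq (E : set X) m Q :
  lim_sup_set (fun n => \bigcup_(B in [set B | cubes D n B /\ 0 < w n B]) B°)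
    `<=` E ->
  cubes D m Q ->
  cube_content mu D (p * s) (E `&` Q) = cube_content mu D (p * s) Q.
Proof.
move=> supE mQ.
have tauE : p * s / fine (hausdorff_dim [set: X]) = p.
  rewrite (hausdorff_dim_regular D s_gt0 X_nontrivial mu_regular b_bounds) /=.
  by rewrite mulfK// gt_eqF.
rewrite /cube_content tauE; apply/eqP; rewrite eq_le; apply/andP; split.
  apply: le_ereal_inf => _ [I [C [IC QC ->]]]; exists I, C; split => //.
  by move=> x [_]; exact: QC.
apply: (@le_trans _ _ (vol Q `^ p)%:E).
  apply: ereal_inf_lbound; exists [set 0%N], (fun=> Q); split.
  - by move=> _ _; exists m.
  - by move=> x Qx; exists 0%N.
  - rewrite esum_set1; first by rewrite (cube_volE mu mQ) poweR_EFin.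
    exact: poweR_ge0.
apply: le_ereal_inf_tmp => _ [I [C [IC QC ->]]].
rewrite leNgt; apply/negP => cheap.
have CD : C @` I `<=` all_cubes D by move=> _ [i Ii <-]; exact: IC.
have Qu : under_covered mu p (C @` I) Q.
  apply: le_lt_trans cheap; apply: (@le_trans _ _ (\esum_(B in C @` I) (vol B `^ p)%:E)%E).
    by apply: esum_subset => B [].
  apply: le_trans (esum_image_le I C _) _.
  apply: le_esum => i /IC[k _ kC].
  by rewrite (cube_volE mu kC) poweR_EFin.
have [x [Qx xE xC]] := uncovered_point CD mQ Qu.
have [i Ii Cix] := QC x (conj (supE _ xE) Qx).
by apply: (xC (C i)) => //; exists i.
Qed.

End content_of_limsup.

(** * Second moments of indicator functions *)

Section second_moment.
Context {d : measure_display} {T : measurableType d} {R : realType}.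
Variable P : probability T R.

Let pr (A : set T) : R := fine (P A).

Let prE (A : set T) : measurable A -> P A = (pr A)%:E.
Proof. by move=> mA; rewrite fineK// fin_num_measure. Qed.

Lemma covariance_indic (A B : set T) : measurable A -> measurable B ->
  covariance P \1_A \1_B = (fine (P (A `&` B)) - fine (P A) * fine (P B))%:E.
Proof.
move=> mA mB.
have L1 E : measurable E -> \1_E \in Lfun P 1.
  by move=> mE; apply/Lfun1_integrable; exact: integrable_indic.
have AB : (\1_A * \1_B = \1_(A `&` B) :> (T -> R))%R by rewrite indicI.
rewrite covarianceE ?AB ?L1//; last exact: measurableI.
rewrite !expectation_indic//; last exact: measurableI.
by rewrite !prE//; exact: measurableI.
Qed.

Lemma integral_centered (A B : set T) : measurable A -> measurable B ->
  (\int[P]_w ((\1_A w - fine (P A)) * (\1_B w - fine (P B)))%:E =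
   (fine (P (A `&` B)) - fine (P A) * fine (P B))%:E)%E.
Proof.
move=> mA mB; rewrite -covariance_indic// unlock !expectation_indic//.
by rewrite unlock.
Qed.

Lemma integrable_centered (A B : set T) : measurable A -> measurable B ->
  P.-integrable setT
    (fun w => ((\1_A w - fine (P A)) * (\1_B w - fine (P B)))%:E).
Proof.
move=> mA mB.
have le1 E w : measurable E -> `|\1_E w - fine (P E)| <= 1.
  move=> mE; have p0 : 0 <= fine (P E) by apply: fine_ge0.
  have p1 : fine (P E) <= 1 by rewrite -lee_fin -/(pr E) -prE// probability_le1.
  by rewrite ler_norml indicE; case: (_ \in _) => /=; lra.
apply: measurable_bounded_integrable => //.
- by rewrite -ge0_fin_numE// fin_num_measure.
- by apply: measurable_funM; apply: measurable_funB => //; exact: measurable_indic.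
- exists 1; split => // M /ltW M1 w _ /=; apply: le_trans M1.
  by rewrite normrM mulr_ile1 ?normr_ge0 ?le1.
Qed.

Lemma second_moment (I : Type) (r : seq I) (c : I -> R) (E : I -> set T) :
  (forall i, measurable (E i)) ->
  (\int[P]_w ((\sum_(i <- r) c i * (\1_(E i) w - fine (P (E i)))) ^+ 2)%:E =
   (\sum_(i <- r) \sum_(j <- r) c i * c j *
      (fine (P (E i `&` E j)) - fine (P (E i)) * fine (P (E j))))%:E)%E.
Proof.
move=> mE.
pose f i j w := ((\1_(E i) w - fine (P (E i))) * (\1_(E j) w - fine (P (E j)))).
have intf i j : P.-integrable setT (fun w => ((c i * c j)%:E * (f i j w)%:E)%E).
  by apply: integrableZl => //; exact: integrable_centered.
transitivity (\int[P]_w \sum_(i <- r) \sum_(j <- r) (c i * c j)%:E * (f i j w)%:E)%E.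
  apply: eq_integral => w _; rewrite expr2 mulr_suml -sumEFin.
  apply: eq_bigr => i _; rewrite mulr_sumr -sumEFin; apply: eq_bigr => j _.
  by rewrite -EFinM /f mulrACA.
rewrite integral_sum//; last by move=> i; apply: integrable_sum => //.
rewrite -sumEFin; apply: eq_bigr => i _.
rewrite integral_sum// -sumEFin; apply: eq_bigr => j _.
rewrite integralZl//; last exact: integrable_centered.
by rewrite integral_centered// -EFinM.
Qed.

(** Markov's inequality along a sparse sequence: if the expectations come
    arbitrarily close to zero, then so do, almost surely, the values. *)
Lemma ae_frequently_small (good : nat -> Prop) (Y : nat -> T -> R) :
  (forall n, measurable_fun setT (Y n)) -> (forall n w, 0 <= Y n w) ->
  (forall (eta : R) N, 0 < eta -> exists n, [/\ (N <= n)%N, good n &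
     (\int[P]_w (Y n w)%:E <= eta%:E)%E]) ->
  {ae P, forall w, forall (zeta : R) N, 0 < zeta ->
     exists n, [/\ (N <= n)%N, good n & Y n w <= zeta]}.
Proof.
move=> mY Y0 smallY.
have inv_gt0 (j : nat) : 0 < (j.+1%:R)^-1 :> R by rewrite invr_gt0.
suff H (z N : nat) : {ae P, forall w,
    exists n, [/\ (N <= n)%N, good n & Y n w <= (z.+1%:R)^-1]}.
  have := ae_foralln (fun z => ae_foralln (H z)).
  apply: filterS => w Hw zeta N zeta0.
  have [n [Nn gn Yn]] := Hw (Num.truncn zeta^-1) N; exists n; split => //.
  apply: (le_trans Yn); rewrite -[leRHS]invrK lef_pV2 ?posrE ?invr_gt0//.
  exact/ltW/truncnS_gt.
have /choice[nn Hnn] : forall j : nat, exists n, [/\ (N <= n)%N, good n &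
     (\int[P]_w (Y n w)%:E <= ((z.+1%:R)^-1 * (j.+1%:R)^-1)%:E)%E].
  by move=> j; apply: smallY; rewrite mulr_gt0.
pose A j := [set w | (z.+1%:R)^-1 < Y (nn j) w].
have mA j : measurable (A j).
  rewrite (_ : A j = setT `&` Y (nn j) @^-1` `](z.+1%:R)^-1, +oo[%classic).
    by apply: mY => //; exact: measurable_itv.
  by rewrite setTI; apply/seteqP; split => w /=; rewrite in_itv/= andbT.
exists (\bigcap_j A j); split.
- by apply: bigcapT_measurable.
- apply/eqP; rewrite eq_le measure_ge0 andbT; apply/lee_addgt0Pr => e e0.
  rewrite add0e; pose j := Num.truncn e^-1.
  apply: (@le_trans _ _ (P (A j))).
    apply: le_measure; [|by apply: mem_set; exact: mA|exact: bigcap_inf].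
    by apply: mem_set; apply: bigcapT_measurable.
  apply: (@le_trans _ _ (j.+1%:R^-1)%:E); last first.
    rewrite lee_fin -[leRHS]invrK lef_pV2 ?posrE ?invr_gt0//.
    exact/ltW/truncnS_gt.
  rewrite -(@lee_pmul2l _ (z.+1%:R^-1)%:E) ?lte_fin//.
  have [_ _ /(le_trans _)] := Hnn j; apply.
  have -> : P (A j) = (\int[P]_w (\1_(A j) w)%:E)%E.
    by rewrite integral_indic// setIT.
  rewrite -integralZl//; last first.
    exact: integrable_indic.
  apply: ge0_le_integral => //.
  + apply/measurable_EFinP; apply: measurable_funM => //; exact: measurable_indic.
  + exact/measurable_EFinP.
  + move=> w _; rewrite -EFinM lee_fin indicE.
    case: (boolP (w \in A j)) => [/set_mem/ltW|_]; first by rewrite mulr1.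
    by rewrite mulr0.
- move=> w /= nw j _; rewrite /A /= ltNge; apply/negP => Yj; apply: nw.
  by have [? ? _] := Hnn j; exists (nn j).
Qed.

End second_moment.

(** * The mean discrepancy of the random weights *)

Lemma geometric_sum_le {R : realFieldType} (u : R) n : 0 <= u < 1 ->
  \sum_(k < n) u ^+ k <= (1 - u)^-1.
Proof.
move=> /andP[u0 u1]; have u10 : 0 < 1 - u by rewrite subr_gt0.
rewrite -[leRHS]mul1r ler_pdivlMr// mulrC.
have := subrX1 u n; have := exprn_ge0 n u0; lra.
Qed.

Lemma geometric_sumV_le {R : realFieldType} (u : R) n : 0 < u < 1 ->
  \sum_(k < n.+1) (u ^+ k)^-1 <= (1 - u)^-1 * (u ^+ n)^-1.
Proof.
move=> /andP[u0 u1]; have un0 k : 0 < u ^+ k by rewrite exprn_gt0.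
rewrite ler_pdivlMr// mulr_suml (reindex_inj rev_ord_inj) /=.
apply: le_trans (_ : _ <= \sum_(k < n.+1) u ^+ k) _; last first.
  by apply: geometric_sum_le; rewrite (ltW u0).
apply: ler_sum => k _; have kn : (k <= n)%N by rewrite -ltnS.
rewrite subSS -[X in _ * u ^+ X](subnK kn).
by rewrite exprD mulrA mulVf ?mul1r ?gt_eqF.
Qed.

Section energy_sum.
Context {R : realType} {X : pmetricType R} {s b : R}.
Variables (mu : probability (borel X) R) (D : dyadic_cubes X b).
Hypothesis s_gt0 : 0 < s.
Hypothesis X_nontrivial : exists x y : X, x <> y.
Hypothesis mu_regular : ahlfors_regular mu s.
Hypothesis b_bounds : 0 < b < 1 / 3.
Implicit Types (n k : nat) (Q B : set X).
Local Notation vol := (volume mu).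
Variable p : R.
Hypothesis p_bounds : 0 < p < 1.

Let mem_cubes n Q : (Q \in cube_list D n) = `[< cubes D n Q >].
Proof. exact: (mem_cube_list D s_gt0 X_nontrivial mu_regular b_bounds). Qed.

Lemma sum_cubes_upto_le n (g : set X -> R) : (forall B, 0 <= g B) ->
  \sum_(B <- cubes_upto D n) g B <=
  \sum_(k < n.+1) \sum_(B <- cube_list D k) g B.
Proof.
move=> g0.
apply: (@le_trans _ _ (\sum_(B <- cubes_upto D n)
   \sum_(k < n.+1) if B \in cube_list D k then g B else 0)).
  rewrite big_seq [X in _ <= X]big_seq; apply: ler_sum => B.
  move=> /(mem_cubes_upto D s_gt0 X_nontrivial mu_regular b_bounds)[k kn kB].
  rewrite (bigD1 (Ordinal (kn : (k < n.+1)%N))) //= mem_cubes (asboolT kB).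
  by rewrite lerDl sumr_ge0// => i _; case: ifP.
rewrite exchange_big /=; apply: ler_sum => k _.
rewrite -big_mkcond -big_filter.
rewrite (perm_big (cube_list D k)); first exact: lexx.
apply: uniq_perm; rewrite ?filter_uniq ?fset_uniq// => B.
rewrite mem_filter; case: (boolP (B \in cube_list D k)) => //=.
rewrite mem_cubes => /asboolP kB.
apply/(mem_cubes_upto D s_gt0 X_nontrivial mu_regular b_bounds).
by exists k => //; rewrite -ltnS.
Qed.

(** The two sums over levels are geometric: the first is dominated by the
    coarse cubes, the second by the finest ones. *)
Lemma energy_sum_le : exists2 c : R, 0 < c & forall n (e f : R),
  0 <= e -> 0 <= f ->
  \sum_(B <- cubes_upto D n) (vol B `^ p)^-1 * (vol B * (e * vol B + f)) <=
  e * c + f * (c * ((b `^ s `^ p) ^+ n)^-1).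
Proof.
have /andP[p0 p1] := p_bounds.
have [K K0 HK] := cube_growth D s_gt0 X_nontrivial mu_regular b_bounds.
have b0 : 0 < b by case/andP: b_bounds.
have b1 : b < 1 by case/andP: b_bounds; lra.
pose a := b `^ s.
have pow_lt1 (y r : R) : 0 < y < 1 -> 0 < r -> 0 < y `^ r < 1.
  move=> /andP[y0 y1] r0; rewrite powR_gt0//=.
  by rewrite /powR gt_eqF// expR_lt1 pmulr_rlt0// ln_lt0// y0 y1.
have a01 : 0 < a < 1 by apply: pow_lt1; rewrite ?b0.
have /andP[a0 a1] := a01.
pose u := a `^ (1 - p); pose v := a `^ p.
have u01 : 0 < u < 1 by apply: pow_lt1; rewrite ?subr_gt0.
have v01 : 0 < v < 1 by apply: pow_lt1.
have /andP[u0 u1] := u01; have /andP[v0 v1] := v01.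
pose c1 := K `^ (1 - p) / (1 - u); pose c2 := K `^ p / (1 - v).
have c10 : 0 < c1 by rewrite divr_gt0 ?powR_gt0 ?subr_gt0.
have c20 : 0 < c2 by rewrite divr_gt0 ?powR_gt0 ?subr_gt0.
exists (c1 + c2); first by rewrite addr_gt0.
move=> n e f e0 f0.
have vn0 : 0 < (v ^+ n)^-1 by rewrite invr_gt0 exprn_gt0.
pose h k := e * (K `^ (1 - p) * u ^+ k) + f * (K `^ p * (v ^+ k)^-1).
have term k B : cubes D k B ->
    (vol B `^ p)^-1 * (vol B * (e * vol B + f)) <= vol B * h k.
  move=> kB.
  have vB := vol_gt0 s_gt0 X_nontrivial mu_regular b_bounds kB.
  have /andP[lo hi] := HK _ _ kB.
  have ak0 : 0 < a ^+ k by rewrite exprn_gt0.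
  have H1 : vol B / vol B `^ p <= K `^ (1 - p) * u ^+ k.
    rewrite (_ : vol B / vol B `^ p = vol B `^ (1 - p)).
      rewrite /u -powR_exprn ?(ltW a0)// -powRM ?(ltW K0) ?(ltW ak0)//.
      rewrite ge0_ler_powR ?nnegrE ?vol_ge0 ?subr_ge0 ?(ltW p1)//.
      by rewrite mulr_ge0 ?ltW.
    by rewrite powRB ?powRr1 ?(ltW vB)// (gt_eqF vB) implybT.
  have H2 : (vol B `^ p)^-1 <= K `^ p * (v ^+ k)^-1.
    rewrite /v -powR_exprn ?(ltW a0)//.
    rewrite -[K `^ p]invrK -invfM lef_pV2 ?posrE ?powR_gt0//; last first.
      by rewrite mulr_gt0 ?invr_gt0 ?powR_gt0.
    rewrite -powRN -[- p]mulN1r powRrM powR_inv1 ?(ltW K0)//.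
    rewrite -powRM ?invr_ge0 ?(ltW K0) ?(ltW ak0)//.
    rewrite ge0_ler_powR ?nnegrE ?vol_ge0 ?(ltW p0)//.
    by rewrite mulr_ge0 ?invr_ge0 ?ltW.
  rewrite mulrCA ler_pM2l// mulrDr mulrCA /h lerD//.
    by rewrite ler_wpM2l// mulrC.
  by rewrite mulrC ler_wpM2l.
have term0 B : 0 <= (vol B `^ p)^-1 * (vol B * (e * vol B + f)).
  by rewrite mulr_ge0 ?invr_ge0 ?powR_ge0// !(mulr_ge0, addr_ge0, vol_ge0).
apply: le_trans (sum_cubes_upto_le n term0) _.
apply: (@le_trans _ _ (\sum_(k < n.+1) h k)).
  apply: ler_sum => k _.
  apply: (@le_trans _ _ (\sum_(B <- cube_list D k) vol B * h k)).
    rewrite big_seq [X in _ <= X]big_seq; apply: ler_sum => B.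
    by rewrite mem_cubes => /asboolP; exact: term.
  rewrite -mulr_suml.
  have := @sum_vol_subcubes _ _ _ _ mu D s_gt0 X_nontrivial mu_regular b_bounds
    0%N k [set: X] (leq0n k) erefl.
  under eq_bigl do rewrite (asboolT (@subsetT _ _)).
  by move=> ->; rewrite /volume probability_setT /= mul1r.
rewrite /h big_split /= -!mulr_sumr.
have U := geometric_sum_le n.+1 (_ : 0 <= u < 1).
have V := geometric_sumV_le n v01.
apply: lerD.
  rewrite ler_wpM2l// (@le_trans _ _ c1)//; last by rewrite lerDl ltW.
  by rewrite /c1 ler_pM2l ?powR_gt0// U// (ltW u0).
rewrite ler_wpM2l// (@le_trans _ _ (c2 * (v ^+ n)^-1))//.
  by rewrite /c2 -mulrA ler_pM2l ?powR_gt0.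
by rewrite ler_pM2r// lerDr ltW.
Qed.

End energy_sum.

Section random_weights.
Context {R : realType} {X : pmetricType R} {s b : R}.
Variables (mu : probability (borel X) R) (D : dyadic_cubes X b).
Hypothesis s_gt0 : 0 < s.
Hypothesis X_nontrivial : exists x y : X, x <> y.
Hypothesis mu_regular : ahlfors_regular mu s.
Hypothesis b_bounds : 0 < b < 1 / 3.
Context {d : measure_display} {Omega : measurableType d}.
Variables (P : probability Omega R) (Z : nat -> set X -> {RV P >-> R}).
Implicit Types (n k : nat) (Q B : set X) (w : Omega).
Local Notation vol := (volume mu).

Definition hit n Q : set Omega := [set w | Z n Q w = 1].

Lemma measurable_hit n Q : measurable (hit n Q).
Proof.
rewrite (_ : hit n Q = Z n Q @^-1` [set 1]); last by apply/seteqP; split.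
exact: measurable_funPTI.
Qed.

(** The volume of [Q], restored on average by dividing by the probability
    that [Q] is selected. *)
Definition weight w n Q : R :=
  vol Q / fine (P (hit n Q)) * \1_(hit n Q) w.

Lemma weight_ge0 w n Q : 0 <= weight w n Q.
Proof. by rewrite mulr_ge0 ?divr_ge0 ?vol_ge0// fine_ge0. Qed.

Lemma weight_gt0_hit w n Q : 0 < weight w n Q -> hit n Q w.
Proof.
rewrite /weight indicE; case: (boolP (w \in hit n Q)) => [/set_mem//|_].
by rewrite mulr0 ltxx.
Qed.

Definition hit_cov n Q Q' : R :=
  fine (P (hit n Q `&` hit n Q')) - fine (P (hit n Q)) * fine (P (hit n Q')).

Let mem_cubes n Q : (Q \in cube_list D n) = `[< cubes D n Q >].
Proof. exact: (mem_cube_list D s_gt0 X_nontrivial mu_regular b_bounds). Qed.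

Lemma hit_cov_le n Q Q' : hit_cov n Q Q' <= fine (P (hit n Q)).
Proof.
rewrite /hit_cov lerBlDr ler_wpDr ?mulr_ge0 ?fine_ge0//.
rewrite fine_le ?fin_num_measure//; [|exact: measurable_hit..|].
  by apply: measurableI; exact: measurable_hit.
apply: le_measure; [..|exact: subIsetl]; apply: mem_set.
  by apply: measurableI; exact: measurable_hit.
exact: measurable_hit.
Qed.

Variables (n : nat) (e M N : R).
Hypothesis e_ge0 : 0 <= e.
Hypothesis M_ge0 : 0 <= M.
Hypothesis hit_gt0 : forall Q, cubes D n Q -> 0 < fine (P (hit n Q)).
Hypothesis weight_le : forall Q, cubes D n Q -> vol Q / fine (P (hit n Q)) <= M.
Hypothesis few_correlated : forall Q, cubes D n Q ->
  \sum_(Q' <- cube_list D n |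
    e * fine (P (hit n Q)) * fine (P (hit n Q')) <= hit_cov n Q Q') 1 <= N.

(** A covariance is at most the probability of either event, so a correlated
    [Q'] contributes at most [vol Q * M], and there are at most [N] of them;
    any other [Q'] contributes at most [e * vol Q * vol Q']. *)
Lemma sum_hit_cov_le k Q B : (k <= n)%N -> cubes D k B -> cubes D n Q ->
  \sum_(Q' <- cube_list D n | `[< Q' `<=` B >])
    vol Q / fine (P (hit n Q)) * (vol Q' / fine (P (hit n Q')))
      * hit_cov n Q Q' <= vol Q * (e * vol B + N * M).
Proof.
move=> kn kB nQ; have qQ := hit_gt0 nQ.
set q := fun Q => fine (P (hit n Q)) in qQ *.
pose corr Q' := e * q Q * q Q' <= hit_cov n Q Q'.
apply: (@le_trans _ _ (\sum_(Q' <- cube_list D n | `[< Q' `<=` B >])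
   vol Q * (e * vol Q' + (if corr Q' then M else 0)))).
  rewrite big_seq_cond [X in _ <= X]big_seq_cond; apply: ler_sum => Q' /andP[].
  rewrite mem_cubes => /asboolP nQ' _.
  have qQ' : 0 < q Q' := hit_gt0 nQ'.
  rewrite -/(q Q) -/(q Q') -!mulrA ler_wpM2l ?vol_ge0//.
  rewrite ler_pdivrMl//; case: ifPn => [_|].
    apply: (@le_trans _ _ (q Q * (vol Q' / q Q'))).
      rewrite mulrA [q Q * _]mulrC ler_wpM2l ?divr_ge0 ?vol_ge0 ?(ltW qQ')//.
      exact: hit_cov_le.
    rewrite ler_pM2l// (le_trans (weight_le nQ'))// lerDr mulr_ge0 ?vol_ge0//.
  rewrite -ltNge addr0 => /ltW H.
  apply: (@le_trans _ _ (vol Q' * ((q Q')^-1 * (e * q Q * q Q')))).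
    by rewrite ler_wpM2l ?vol_ge0// ler_wpM2l ?invr_ge0// ltW.
  rewrite [_^-1 * _]mulrC mulfK ?gt_eqF//.
  by rewrite (_ : vol Q' * (e * q Q) = q Q * (e * vol Q'))//; ring.
rewrite -mulr_sumr ler_wpM2l ?vol_ge0// big_split /= lerD//.
  rewrite -mulr_sumr ler_wpM2l//.
  by rewrite (sum_vol_subcubes s_gt0 X_nontrivial mu_regular b_bounds kn kB).
apply: (@le_trans _ _ (\sum_(Q' <- cube_list D n | corr Q') M)).
  rewrite big_mkcond [X in _ <= X]big_mkcond; apply: ler_sum => Q' _.
  by case: ifP => //; case: ifP.
rewrite -[X in \sum_(_ <- _ | _) X]mul1r -mulr_suml ler_wpM2r//.
exact: few_correlated.
Qed.

Lemma mass_variance_le k B : (k <= n)%N -> cubes D k B ->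
  (\int[P]_w ((mass_in D (weight w n) n B - vol B) ^+ 2)%:E <=
     (vol B * (e * vol B + N * M))%:E)%E.
Proof.
move=> kn kB.
have massE w : mass_in D (weight w n) n B - vol B =
  \sum_(Q <- [seq Q <- cube_list D n | `[< Q `<=` B >]])
     vol Q / fine (P (hit n Q)) * (\1_(hit n Q) w - fine (P (hit n Q))).
  rewrite (mass_inE s_gt0 X_nontrivial mu_regular b_bounds _ kn kB).
  rewrite big_filter big_seq_cond [RHS]big_seq_cond; apply: eq_bigr => Q /andP[].
  rewrite mem_cubes => /asboolP nQ _.
  by rewrite mulrBr divfK// gt_eqF// hit_gt0.
under eq_integral do rewrite massE.
rewrite second_moment; last by move=> Q; exact: measurable_hit.
rewrite lee_fin big_filter.
rewrite -[X in X * (e * _ + _)](sum_vol_subcubes s_gt0 X_nontrivial mu_regular b_bounds kn kB).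
rewrite mulr_suml big_seq_cond [X in _ <= X]big_seq_cond.
apply: ler_sum => Q /andP[]; rewrite mem_cubes => /asboolP nQ _.
by rewrite big_filter; exact: (sum_hit_cov_le kn kB nQ).
Qed.

Lemma measurable_mass B : measurable_fun setT
  (fun w => (mass_in D (weight w n) n B - vol B) ^+ 2).
Proof.
apply: measurable_funX; apply: measurable_funB => //.
rewrite /mass_in; under eq_fun do rewrite -big_filter.
apply: measurable_sum => Q; apply: measurable_funM => //.
exact/measurable_indic/measurable_hit.
Qed.

Variable p : R.

Lemma measurable_discrepancy :
  measurable_fun setT (fun w => discrepancy mu D p (weight w n) n).
Proof.
by apply: measurable_sum => B; apply: measurable_funM => //; exact: measurable_mass.
Qed.

Lemma discrepancy_mean_le :
  (\int[P]_w (discrepancy mu D p (weight w n) n)%:E <=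
   (\sum_(B <- cubes_upto D n)
      (vol B `^ p)^-1 * (vol B * (e * vol B + N * M)))%:E)%E.
Proof.
under eq_integral do rewrite /discrepancy -sumEFin.
rewrite ge0_integral_sum//; first last.
- by move=> B w _; rewrite lee_fin discrepancy_term_ge0.
- move=> B; apply/measurable_EFinP; apply: measurable_funM => //.
  exact: measurable_mass.
rewrite -sumEFin big_seq [X in (_ <= X)%E]big_seq; apply: lee_sum => B.
move=> /(mem_cubes_upto D s_gt0 X_nontrivial mu_regular b_bounds)[k kn kB].
under eq_integral do rewrite EFinM.
have i0 : 0 <= (vol B `^ p)^-1 by rewrite invr_ge0 powR_ge0.
rewrite ge0_integralZl//; first last.
- by move=> w _; rewrite lee_fin sqr_ge0.
- by apply/measurable_EFinP; exact: measurable_mass.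
by rewrite EFinM lee_wpmul2l// ?lee_fin// (mass_variance_le kn kB).
Qed.

End random_weights.

(** * Consequences of the index and of the Correlation Condition *)

Section logarithms.
Context {R : realType} {b : R}.
Hypothesis b01 : 0 < b < 1.

Let lnb_gt0 : 0 < ln b^-1.
Proof.
by case/andP: b01 => b0 b1; rewrite ln_gt0// invf_gt1.
Qed.

Let ln_bV : ln b = - ln b^-1.
Proof. by rewrite lnV ?opprK// posrE; case/andP: b01. Qed.

Lemma logb_le (q r : R) : 0 <= q -> q <= b `^ r -> (logb (b := b) q%:E <= (- r)%:E)%E.
Proof.
rewrite le_eqVlt => /orP[/eqP <- _|q0 qb].
  by rewrite /logb le0_lneNy// mulNyr gtr0_sg ?invr_gt0// mul1e leNye.
rewrite /logb lne_EFin// -EFinM lee_fin ler_pdivrMr//.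
rewrite mulNr -mulrN -ln_bV -ln_powR ler_ln ?posrE//.
by rewrite powR_gt0//; case/andP: b01.
Qed.

Lemma le_of_logb (y : \bar R) (r : R) : (0 <= y)%E ->
  (logb (b := b) y <= r%:E)%E -> (y <= (b `^ (- r))%:E)%E.
Proof.
case: y => [y|_|//]; last first.
  by rewrite /logb /= mulyr gtr0_sg ?invr_gt0// mul1e leye_eq.
rewrite lee_fin le_eqVlt => /orP[/eqP <- _|y0].
  by rewrite lee_fin powR_ge0.
rewrite /logb lne_EFin// -EFinM !lee_fin ler_pdivrMr// => H.
rewrite -ler_ln ?posrE//; last by rewrite powR_gt0//; case/andP: b01.
by rewrite ln_powR ln_bV mulrNN.
Qed.

End logarithms.

Section limsup_of_sequences.
Context {R : realType}.
Implicit Types (u : nat -> \bar R) (r : R).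
Local Open Scope ereal_scope.

Lemma limn_esup_lt_eventually u r : limn_esup u < r%:E ->
  exists N, forall n, (N <= n)%N -> u n < r%:E.
Proof.
move=> /ereal_inf_lt[_ [V [N _ NV] <-] supV]; exists N => n Nn.
by apply: le_lt_trans supV; apply: ereal_sup_ubound; exists n => //; exact: NV.
Qed.

Lemma limn_esup_le_eventually u r N : (forall n, (N <= n)%N -> u n <= r%:E) ->
  limn_esup u <= r%:E.
Proof.
move=> uN; apply: (@le_trans _ _ (ereal_sup (u @` [set n | (N <= n)%N]))).
  apply: ereal_inf_lbound; exists [set n | (N <= n)%N] => //.
  by exists N.
by apply: ge_ereal_sup => _ [n /= Nn <-]; exact: uN.
Qed.

End limsup_of_sequences.

Section indices.
Context {R : realType} {X : pmetricType R} {s b : R}.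
Variables (mu : probability (borel X) R) (D : dyadic_cubes X b).
Hypothesis s_gt0 : 0 < s.
Hypothesis X_nontrivial : exists x y : X, x <> y.
Hypothesis mu_regular : ahlfors_regular mu s.
Hypothesis b_bounds : 0 < b < 1 / 3.
Context {d : measure_display} {Omega : measurableType d}.
Variables (P : probability Omega R) (Z : nat -> set X -> {RV P >-> R}).
Hypothesis Z01 : forall (n : nat) (Q : set X), (0 < n)%N -> cubes D n Q ->
       forall w : Omega, Z n Q w = 0 \/ Z n Q w = 1.

Let b01 : 0 < b < 1. Proof. by case/andP: b_bounds => -> /=; lra. Qed.
Let b_gt0 : 0 < b. Proof. by case/andP: b01. Qed.

Let q n Q : R := fine (P (hit Z n Q)).

Let hit_probE n Q : hit_prob Z n Q = (q n Q)%:E.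
Proof. by rewrite fineK// fin_num_measure//; exact: measurable_hit. Qed.

Lemma gamma2_ge0 : (0 <= gamma2 D Z)%E.
Proof.
rewrite /gamma2 leeNr oppe0; apply: (@limn_esup_le_eventually _ _ _ 0%N) => n _.
have [Q nQ _] := cubes_cover D n point.
rewrite mule_le0_ge0 ?lee_fin//.
apply: (@le_trans _ _ (logb (b := b) (hit_prob Z n Q))).
  by apply: ereal_inf_lbound; exists Q.
rewrite -[leRHS]/(0%:E) -[0]oppr0 hit_probE logb_le// ?fine_ge0//.
by rewrite powRr0 -lee_fin -hit_probE probability_le1//; exact: measurable_hit.
Qed.

Lemma frequently_likely_hits (r : R) N : (gamma2 D Z < r%:E)%E ->
  exists n, [/\ (N <= n)%N, (0 < n)%N &
    forall Q, cubes D n Q -> (b `^ r) ^+ n <= q n Q].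
Proof.
move=> gr; apply: contrapT => noN; move: gr; apply/negP; rewrite -leNgt.
rewrite /gamma2 leeNr; apply: (@limn_esup_le_eventually _ _ _ N.+1) => n Nn.
have n0 : (0 < n)%N by apply: leq_trans Nn.
have [Q nQ qQ] : exists2 Q, cubes D n Q & q n Q < (b `^ r) ^+ n.
  apply: contrapT => noQ; apply: noN; exists n; split => //; first exact: ltnW.
  by move=> Q nQ; rewrite leNgt; apply/negP => qQ; apply: noQ; exists Q.
apply: (@le_trans _ _ (logb (b := b) (hit_prob Z n Q) * (n%:R^-1)%:E)%E).
  rewrite lee_pmul2r ?lte_fin ?invr_gt0 ?ltr0n//.
  by apply: ereal_inf_lbound; exists Q.
rewrite lee_pdivrMr ?ltr0n// hit_probE -EFinM mulNr logb_le ?fine_ge0//.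
by rewrite powRrM powR_mulrn ?powR_ge0// ltW.
Qed.

Lemma covariance_hit n Q Q' : (0 < n)%N -> cubes D n Q -> cubes D n Q' ->
  covariance P (Z n Q) (Z n Q') = (hit_cov Z n Q Q')%:E.
Proof.
move=> n0 nQ nQ'.
have ZE B : cubes D n B -> (Z n B : Omega -> R) = \1_(hit Z n B).
  move=> nB; apply/funext => w; rewrite indicE.
  have [Z0|Z1] := Z01 n0 nB w; last by rewrite Z1 mem_set.
  by rewrite Z0 memNset// /hit /= Z0 => /esym/eqP; rewrite oner_eq0.
by rewrite !ZE// covariance_indic//; exact: measurable_hit.
Qed.

Lemma eventually_few_correlated (delta r e : R) :
  correlation_condition D Z delta -> delta < r -> 0 < e ->
  exists N, forall n, (N <= n)%N -> (0 < n)%N -> forall Q, cubes D n Q ->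
    \sum_(Q' <- cube_list D n | e * q n Q * q n Q' <= hit_cov Z n Q Q') 1
      <= ((b `^ r) ^+ n)^-1.
Proof.
move=> corr dr e0.
have [N HN] : exists N, forall n, (N <= n)%N ->
    ((n%:R^-1)%:E * logb (b := b) (corr_count D Z n e) < r%:E)%E.
  by apply: limn_esup_lt_eventually; apply: le_lt_trans (corr e e0) _.
exists N => n Nn n0 Q nQ.
set S := [set Q' | cubes D n Q' /\
  (e%:E * hit_prob Z n Q * hit_prob Z n Q' <= covariance P (Z n Q) (Z n Q'))%E].
have Scount : (counting S <= corr_count D Z n e)%E.
  by apply: ereal_sup_ubound; exists Q.
have finS : finite_set S.
  apply: (@sub_finite_set _ _ (cubes D n)); first by move=> ? [].
  exact: (finite_cubes D s_gt0 X_nontrivial mu_regular b_bounds).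
have cnt0 : (0 <= counting S)%E by rewrite /counting asboolT// lee_fin.
have : (corr_count D Z n e <= (b `^ (- (r * n%:R)))%:E)%E.
  apply: (le_of_logb b01); first exact: le_trans Scount.
  have := ltW (HN n Nn).
  by rewrite muleC lee_pdivrMr ?ltr0n// -EFinM.
move=> /(le_trans Scount).
rewrite /counting asboolT// lee_fin powRN powRrM powR_mulrn ?powR_ge0//.
apply: le_trans.
rewrite -big_filter big_const_seq count_predT iter_addr_0 ler_nat.
apply: uniq_leq_size; first by rewrite filter_uniq ?fset_uniq.
move=> Q'; rewrite mem_filter => /andP[cQ'].
rewrite (mem_cube_list D s_gt0 X_nontrivial mu_regular b_bounds) => /asboolP nQ'.
rewrite in_fset_set//; apply: mem_set; split => //.
by rewrite covariance_hit// !hit_probE -!EFinM lee_fin.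
Qed.

End indices.

(** * Almost sure regularity and conclusion *)

Section almost_sure_content.
Context {R : realType} {X : pmetricType R} {s b : R}.
Variables (mu : probability (borel X) R) (D : dyadic_cubes X b).
Hypothesis s_gt0 : 0 < s.
Hypothesis X_nontrivial : exists x y : X, x <> y.
Hypothesis mu_regular : ahlfors_regular mu s.
Hypothesis b_bounds : 0 < b < 1 / 3.
Context {d : measure_display} {Omega : measurableType d}.
Variables (P : probability Omega R) (Z : nat -> set X -> {RV P >-> R}).
Hypothesis Z01 : forall (n : nat) (Q : set X), (0 < n)%N -> cubes D n Q ->
       forall w : Omega, Z n Q w = 0 \/ Z n Q w = 1.
Local Notation vol := (volume mu).

Lemma regular_weights_le (p p' C1 : R) w : p' <= p -> 0 <= C1 ->
  regular_weights mu D p C1 w -> regular_weights mu D p' C1 w.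
Proof.
move=> pp C10 H zeta N zeta0; have [n [Nn wC disc]] := H zeta N zeta0.
have vpp k B : cubes D k B -> vol B `^ p <= vol B `^ p'.
  move=> kB; apply: ger_powR => //.
  by rewrite (vol_gt0 s_gt0 X_nontrivial mu_regular b_bounds kB) (vol_le1 mu kB).
exists n; split => //.
  by move=> B nB; rewrite (le_trans (wC B nB))// ler_wpM2l// (vpp n).
apply: le_trans disc; rewrite /discrepancy big_seq [leRHS]big_seq.
apply: ler_sum => B.
move=> /(mem_cubes_upto D s_gt0 X_nontrivial mu_regular b_bounds)[k kn kB].
have vB := vol_gt0 s_gt0 X_nontrivial mu_regular b_bounds kB.
by rewrite ler_wpM2r ?sqr_ge0// lef_pV2 ?posrE ?powR_gt0// (vpp k).
Qed.

(** At the levels supplied by the definition of [gamma2] the factor [N * M] of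
    the variance bound is at most about
    [b ^ (n * (s - gamma2 - delta - 2 * eps))], and the sum over the levels
    costs another [b ^ (- n * t')]. With [eps] a quarter of the gap between
    [t'] and [s - gamma2 - delta], the product still decays, like
    [b ^ (2 * n * eps)]. The remaining part of the bound is proportional to the
    threshold [e] of the Correlation Condition, which is arbitrary. *)
Lemma ae_regular_weights (delta g t' : R) : 0 <= delta -> 0 <= g ->
  gamma2 D Z = g%:E -> correlation_condition D Z delta ->
  0 < t' -> t' < s - g - delta ->
  exists2 C1 : R, 0 <= C1 &
  {ae P, forall w, regular_weights mu D (t' / s) C1 (weight mu Z w)}.
Proof.
move=> delta0 g0 gE corr t'0 t't.
have b0 : 0 < b by case/andP: b_bounds.
have b1 : b < 1 by case/andP: b_bounds; lra.
set p := t' / s.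
have p0 : 0 < p by rewrite divr_gt0.
have p1 : p < 1 by rewrite ltr_pdivrMr// mul1r; lra.
have p01 : 0 < p < 1 by rewrite p0.
have psE : s * p = t' by rewrite /p mulrCA divff ?mulr1// gt_eqF.
pose eps := (s - g - delta - t') / 4.
have eps0 : 0 < eps by rewrite divr_gt0//; lra.
have epsE : s - g - delta - t' = 4 * eps by rewrite /eps; field.
have [K K0 HK] := cube_growth D s_gt0 X_nontrivial mu_regular b_bounds.
have [c c0 Hc] := energy_sum_le D s_gt0 X_nontrivial mu_regular b_bounds p01.
pose q n Q := fine (P (hit Z n Q)).
pose C1 := K `^ (1 - p).
have C10 : 0 <= C1 by apply: powR_ge0.
have bnz : b != 0 by rewrite gt_eqF.
have bp (x : R) n : 0 < (b `^ x) ^+ n by rewrite exprn_gt0// powR_gt0.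
have bD (x y : R) n : (b `^ x) ^+ n * (b `^ y) ^+ n = (b `^ (x + y)) ^+ n.
  by rewrite -exprMn powRD// bnz implybT.
have bV (x : R) n : ((b `^ x) ^+ n)^-1 = (b `^ (- x)) ^+ n by rewrite powRN exprVn.
pose good n := (0 < n)%N /\
  forall B, cubes D n B -> vol B / q n B <= C1 * vol B `^ p.
exists C1 => //.
have : {ae P, forall w, forall (zeta : R) N, 0 < zeta ->
     exists n, [/\ (N <= n)%N, good n &
       discrepancy mu D p (weight mu Z w n) n <= zeta]}.
  apply: ae_frequently_small.
  - by move=> n; exact: measurable_discrepancy.
  - by move=> n w; apply: sumr_ge0 => B _; exact: discrepancy_term_ge0.
  move=> eta N eta0.
  pose e := eta / (2 * c).
  have e0 : 0 < e by rewrite divr_gt0// mulr_gt0.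
  have dlt : delta < delta + eps by rewrite ltrDl.
  have [N1 HN1] := eventually_few_correlated s_gt0 X_nontrivial mu_regular
    b_bounds Z01 corr dlt e0.
  have [N2 HN2] : exists N2, forall n, (N2 <= n)%N ->
      (b `^ (2 * eps)) ^+ n < eta / (2 * (K * c)).
    apply: expr_eventually_lt; last by rewrite divr_gt0// !mulr_gt0.
    have eps20 : 0 < 2 * eps by apply: mulr_gt0.
    rewrite powR_ge0/= /powR (negbTE bnz) expR_lt1 (pmulr_rlt0 _ eps20).
    by rewrite ln_lt0// b0.
  have gr : (gamma2 D Z < (g + eps)%:E)%E by rewrite gE lte_fin ltrDl.
  have [n [Nn n0 qn]] := frequently_likely_hits b_bounds (maxn N (maxn N1 N2)) gr.
  have NN : (N <= n)%N by apply: leq_trans Nn; rewrite leq_maxl.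
  have N1n : (N1 <= n)%N.
    by apply: leq_trans Nn; rewrite leq_max leq_maxl orbT.
  have N2n : (N2 <= n)%N.
    by apply: leq_trans Nn; rewrite leq_max leq_maxr orbT.
  have q0 Q : cubes D n Q -> 0 < q n Q.
    by move=> nQ; apply: lt_le_trans (qn Q nQ); exact: bp.
  have qV Q : cubes D n Q -> (q n Q)^-1 <= (b `^ (- (g + eps))) ^+ n.
    by move=> nQ; rewrite -bV lef_pV2 ?posrE ?q0 ?bp//; exact: qn.
  pose M := K * (b `^ (s - (g + eps))) ^+ n.
  have M0 : 0 <= M by rewrite mulr_ge0 ?(ltW K0)// ltW.
  have vM Q : cubes D n Q -> vol Q / q n Q <= M.
    move=> nQ; have /andP[_ hi] := HK _ _ nQ.
    rewrite /M -bD mulrA ler_pM ?vol_ge0 ?qV// invr_ge0 ltW// q0//.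
  exists n; split => //.
    split=> // B nB; have vB := vol_gt0 s_gt0 X_nontrivial mu_regular b_bounds nB.
    have -> : vol B = vol B `^ (1 - p) * vol B `^ p.
      by rewrite -powRD ?subrK ?powRr1 ?(ltW vB)// (gt_eqF vB) implybT.
    rewrite -{2}(_ : vol B = vol B `^ (1 - p) * vol B `^ p); last first.
      by rewrite -powRD ?subrK ?powRr1 ?(ltW vB)// (gt_eqF vB) implybT.
    rewrite mulrAC ler_wpM2r ?powR_ge0//.
    apply: (@le_trans _ _ (C1 * ((b `^ s) `^ (1 - p)) ^+ n * (b `^ (- (g + eps))) ^+ n)).
      apply: ler_pM; rewrite ?powR_ge0 ?invr_ge0 ?(ltW (q0 _ nB)) ?qV//.
      rewrite /C1 -powR_exprn ?powR_ge0// -powRM ?(ltW K0) ?(ltW (bp _ _))//.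
      have /andP[_ hi] := HK _ _ nB.
      by rewrite ge0_ler_powR ?nnegrE ?vol_ge0 ?subr_ge0 ?(ltW p1)// mulr_ge0 ?ltW.
    rewrite -mulrA -powRrM bD -[leRHS]mulr1 ler_wpM2l//.
    rewrite exprn_ile1 ?powR_ge0//.
    rewrite /powR (negbTE bnz) expR_le1 mulr_ge0_le0 ?ln_le0 ?(ltW b1)//.
    by rewrite mulrBr mulr1 psE; lra.
  have := discrepancy_mean_le s_gt0 X_nontrivial mu_regular b_bounds
    (ltW e0) M0 q0 vM (HN1 n N1n n0) p.
  move=> /le_trans; apply; rewrite lee_fin.
  have f0 : 0 <= ((b `^ (delta + eps)) ^+ n)^-1 * M.
    by rewrite mulr_ge0 ?invr_ge0// ltW.
  apply: (le_trans (Hc n e _ (ltW e0) f0)).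
  have -> : e * c = eta / 2 by rewrite /e; field; rewrite gt_eqF.
  rewrite [leRHS](splitr eta) lerD2l.
  rewrite -powRrM psE !bV /M.
  rewrite (_ : _ * _ = (K * c) * ((b `^ (- (delta + eps))) ^+ n
     * (b `^ (s - (g + eps))) ^+ n * (b `^ (- t')) ^+ n)); last ring.
  rewrite !bD (_ : - (delta + eps) + (s - (g + eps)) + - t' = 2 * eps); last first.
    by move: epsE; lra.
  have := HN2 n N2n; rewrite ltr_pdivlMr ?mulr_gt0// => H.
  by rewrite ler_pdivlMr// mulrC mulrA mulrC ltW.
apply: filterS => w Hw zeta N zeta0.
have [n [Nn [n0 gn] disc]] := Hw zeta N zeta0; exists n; split => //.
move=> B nB; apply: le_trans (gn B nB); rewrite /weight indicE.
by case: (_ \in _) => /=; rewrite ?mulr1// mulr0 divr_ge0 ?vol_ge0// fine_ge0.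
Qed.

End almost_sure_content.

Lemma Gdelta_lim_sup_set {T : topologicalType} (F : nat -> set T) :
  (forall n, open (F n)) -> Gdelta (lim_sup_set F).
Proof.
move=> oF; exists (fun m => \bigcup_(n in [set n | (m <= n)%N]) F n) => //.
by move=> m; apply: bigcup_open => n _; exact: oF.
Qed.

Theorem theorem4p1 (R : realType) (X : pmetricType R) (s b : R)
    (mu : probability (borel X) R) (D : dyadic_cubes X b)
    (d : measure_display) (Omega : measurableType d) (P : probability Omega R)
    (Z : nat -> set X -> {RV P >-> R}) (delta : R)
    (s_gt0 : 0 < s)
    (X_compact : compact [set: X])
    (X_nontrivial : exists x y : X, x <> y)
    (mu_regular : ahlfors_regular mu s)
    (b_bounds : 0 < b < 1 / 3)
    (Z01 : forall (n : nat) (Q : set X), (0 < n)%N -> cubes D n Q ->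
       forall w : Omega, Z n Q w = 0 \/ Z n Q w = 1)
    (delta_ge0 : 0 <= delta)
    (corr : correlation_condition D Z delta)
    (gamma2_lt : (gamma2 D Z + delta%:E < s%:E)%E) :
  {ae P, forall w : Omega,
     large_intersection mu D (s - fine (gamma2 D Z) - delta)
       (limsup_fractal D Z w)}.
Proof.
have g2_ge0 : (0 <= gamma2 D Z)%E by exact: gamma2_ge0.
have g2_fin : gamma2 D Z \is a fin_num.
  rewrite ge0_fin_numE//; apply: le_lt_trans (lt_trans gamma2_lt (ltry s)).
  by rewrite leeDl// lee_fin.
set g := fine (gamma2 D Z); have gE : gamma2 D Z = g%:E by rewrite fineK.
have g0 : 0 <= g by rewrite fine_ge0.
set t := s - g - delta.
have t0 : 0 < t.
  by move: gamma2_lt; rewrite gE -EFinD lte_fin /t; lra.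
(* a sequence of exponents below t that tends to t *)
pose tt (j : nat) := t - t / j.+2%:R.
have ttt j : tt j < t by rewrite /tt ltrBlDr ltrDl divr_gt0.
have tt0 j : 0 < tt j.
  by rewrite /tt subr_gt0 ltr_pdivrMr// ltr_pMr// ltr1n.
have /choice[C1 HC1] : forall j, exists C1 : R, 0 <= C1 /\
    {ae P, forall w, regular_weights mu D (tt j / s) C1 (weight mu Z w)}.
  move=> j; have [C1 C10 H] := ae_regular_weights s_gt0 X_nontrivial mu_regular
    b_bounds Z01 delta_ge0 g0 gE corr (tt0 j) (ttt j).
  by exists C1.
have := ae_foralln (fun j => (HC1 j).2).
apply: filterS => w Hw; split.
  apply: Gdelta_lim_sup_set => n; apply: bigcup_open => Q _.
  exact: open_interior.
move=> t' Q t'0 t't [m _ mQ].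
have [j jt] : exists j, t' <= tt j.
  exists (Num.truncn (t / (t - t'))).
  have tt'0 : 0 < t - t' by rewrite subr_gt0.
  rewrite /tt lerBrDl -lerBrDr ler_pdivrMr// mulrC -ler_pdivrMr//.
  rewrite (le_trans (ltW (truncnS_gt _)))// ler_nat//.
have p01 : 0 < t' / s < 1.
  rewrite divr_gt0//= ltr_pdivrMr// mul1r (lt_le_trans t't)// /t.
  by move: g0 delta_ge0; lra.
have reg : regular_weights mu D (t' / s) (C1 j) (weight mu Z w).
  apply: (regular_weights_le s_gt0 X_nontrivial mu_regular b_bounds _ _ (Hw j)).
    by rewrite ler_pM2r// invr_gt0.
  by have [] := HC1 j.
have := @cube_content_eq _ _ s b mu D s_gt0 X_nontrivial mu_regular b_bounds
  X_compact (weight mu Z w) (t' / s) (C1 j) p01 (HC1 j).1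
  (weight_ge0 mu Z w) reg (limsup_fractal D Z w) m Q.
rewrite divfK ?gt_eqF//; apply => // x Hx N _.
have [n Nn [B [nB wB] Bx]] := Hx N I; exists n => //; exists B => //.
by split => //; exact: weight_gt0_hit wB.
Qed.
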